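(* Let $u\in H$ and let $\widehat\lambda\in\Lambda^+$ be a solution of $j(\widehat\lambda)=\min\{j(\lambda):\lambda\in\Lambda^+\}$. Let $T_u=\mathrm{span}\{g'(\widehat\lambda;\ell):\ell\in\Lambda\}$ and let $P_u:H\to T_u$ be the projection operator with respect to the inner product $e''(u;\cdot,\cdot)$, i.e. $e''(u;w-P_uw,v)=0$ for all $w\in H$ and $v\in T_u$. Let $h\in H$ be Newton's step, i.e. the solution of $e''(u;h,v)=e'(u;v)$ for all $v\in H$, and write $g=g(\widehat\lambda)$. Then $$P_uh=P_u(\kappa g)\qquad\text{and}\qquad d\le\dim(T_u)\le N,$$ where $d$ is the number of indices $i\in\{1,\dots,N\}$ such that $g(\widehat\lambda)\ne g_0$ in $\mathcal D'(\Omega_i)$.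
   Context: Let $\Omega\subset\mathbb R^d$, $d\ge1$, be a sufficiently smooth (Lipschitz) domain and $H=H^1_0(\Omega)$ with $(u,v)_H=\int_\Omega \nabla u\cdot\nabla v+uv\,dx$, $\|u\|_H=(u,u)_H^{1/2}$. (The dimension of the space containing $\Omega$ is unrelated to the integer $d$ counted in the claim.) The functional $e:H\to\mathbb R$ is $C^2$ in $H$; $e'(u;v)$ and $e''(u;v,w)$ denote its first and second derivatives at $u$ in the directions $v$ and $v,w$. There are constants $M,m>0$ with $|e''(u;v,w)|\le M\|v\|_H\|w\|_H$ and $e''(u;v,v)\ge m\|v\|_H^2$ for all $u,v,w\in H$. A step size $\kappa>0$ is fixed. Let $\{\Omega_i\}_{i\in I}$, $I=\{1,\dots,N\}$, be a partition of $\Omega$ into open Lipschitz sets. $\Lambda\subset L^\infty(\Omega)$ is the $N$-dimensional space of functions $\lambda:\Omega\to\mathbb R$ that are constant, equal to $\lambda_i\in\mathbb R$, on each $\Omega_i$, and $\Lambda^+=\{\lambda\in\Lambda: 0<\lambda_i<\infty\ \forall i\}$. For given $u\in H$ and $\lambda\in\Lambda^+$, $g(\lambda)\in H$ is the unique solution of $\int_\Omega\lambda\,\nabla g(\lambda)\cdot\nabla v+g(\lambda)v\,dx=e'(u;v)$ for all $v\in H$; and $j(\lambda)=f(g(\lambda))$ with $f(g)=\frac{\kappa}{2}e''(u;g,g)-e'(u;g)$. $g'(\widehat\lambda;\ell)\in H$ is the derivative of $\lambda\mapsto g(\lambda)$ at $\widehat\lambda$ in the direction $\ell\in\Lambda$.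 $g_0$ is the $L^2$ representation of $e'(u)$ (formally $\int_\Omega g_0v\,dx=e'(u;v)$), which as a distribution satisfies $-\nabla\cdot(\lambda\nabla g(\lambda))+g(\lambda)=g_0$ in $\mathcal D'(\Omega)$ for $\lambda\in\Lambda^+$; in general $g_0\notin H^1_0(\Omega)$. *)

(* Defs.v *)
From HB Require Import structures.
From mathcomp Require Import all_boot all_order all_algebra.
From mathcomp Require Import all_classical all_reals all_analysis.
From mathcomp Require Import measurable_realfun.
From mathcomp Require Import ring lra.
Set Implicit Arguments. Unset Strict Implicit. Unset Printing Implicit Defensive.
Import Order.TTheory GRing.Theory Num.Theory.
Import numFieldNormedType.Exports.
Local Open Scope classical_set_scope.
Local Open Scope ring_scope.

Section measurable_rV.
Context {R : realType} (n : nat).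

Let coors : 'I_n -> 'rV[R]_n -> R := fun i v => v ord0 i.

Let rV_set0 : g_sigma_preimage coors set0.
Proof. exact: sigma_algebra0. Qed.

Let rV_setC A : g_sigma_preimage coors A -> g_sigma_preimage coors (~` A).
Proof. exact: sigma_algebraC. Qed.

Let rV_bigcup (F : _^nat) : (forall i, g_sigma_preimage coors (F i)) ->
  g_sigma_preimage coors (\bigcup_i (F i)).
Proof. exact: sigma_algebra_bigcup. Qed.

HB.instance Definition _ := @isMeasurable.Build default_measure_display
  'rV[R]_n (g_sigma_preimage coors) rV_set0 rV_setC rV_bigcup.

Lemma measurable_coord (i : 'I_n) :
  measurable_fun [set: 'rV[R]_n] (fun v : 'rV[R]_n => v ord0 i).
Proof.
move=> _ Y mY; rewrite setTI; apply: sub_sigma_algebra => /=.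
rewrite -bigcup_seq/=; exists i => /=; first by rewrite mem_index_enum.
by exists Y => //; rewrite setTI.
Qed.

Lemma measurable_fun_rV d (T : measurableType d) (f : T -> 'rV[R]_n) :
  (forall i, measurable_fun [set: T] (fun x => f x ord0 i)) ->
  measurable_fun [set: T] f.
Proof.
move=> mf.
have prefS : g_sigma_preimage (fun i => coors i \o f) `<=` measurable.
  apply: smallest_sub; first exact: sigma_algebra_measurable.
  move=> A; rewrite -bigcup_seq/= => -[i _ [B mB <-]].
  exact: mf.
by rewrite g_sigma_preimage_comp in prefS => _ A mA; apply: prefS; exists A.
Qed.

Lemma open_measurable_rV (A : set 'rV[R]_n) : open A -> measurable A.
Proof.
move=> oA.
pose box (q : 'rV[rat]_n) (k : nat) : set 'rV[R]_n :=
  [set v | forall i, `|ratr (q ord0 i) - v ord0 i| < k.+1%:R^-1].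
pose F (qk : 'rV[rat]_n * nat) := if asbool (box qk.1 qk.2 `<=` A)
  then box qk.1 qk.2 else set0.
have mF qk : measurable (F qk).
  rewrite /F; case: ifP => // _.
  rewrite (_ : box _ _ = \big[setI/setT]_(i < n)
    ((fun v : 'rV[R]_n => v ord0 i) @^-1`
      ball (ratr (qk.1 ord0 i) : R) qk.2.+1%:R^-1)); last first.
    apply/seteqP; split => v.
      by move=> bv; rewrite -bigcap_seq => i _ /=; exact: bv.
    by rewrite -bigcap_seq => h i; apply: (h i); rewrite /= mem_index_enum.
  apply: bigsetI_measurable => i _.
  rewrite -[X in measurable X]setTI; apply: measurable_coord => //.
  by apply: open_measurable; exact: ball_open.
rewrite (_ : A = \bigcup_qk F qk); last first.
  apply/seteqP; split=> [v Av|v [qk _]]; last first.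
    by rewrite /F; case: ifP => // /asboolP; apply.
  have /nbhs_ballP[e /= e0 beA] := open_nbhs_nbhs (conj oA Av).
  have [k ke] : exists k, k.+1%:R^-1 < e / 2 :> R.
    have [k _ /(_ k (leqnn k))] := near_infty_natSinv_lt (PosNum (divr_gt0 e0 (ltr0Sn R 1))).
    by exists k.
  have [q qv] : exists q : 'rV[rat]_n, box q k v.
    have h i : exists q : rat, `|ratr q - v ord0 i| < k.+1%:R^-1.
      have : v ord0 i - k.+1%:R^-1 < v ord0 i + k.+1%:R^-1.
        by rewrite ltrD2l gt0_cp// invr_gt0.
      by move=> /rat_in_itvoo[q]; rewrite in_itv/= -ltr_distl; exists q.
    exists (\row_i projT1 (cid (h i))) => i; rewrite mxE.
    exact: (projT2 (cid (h i))).
  exists (q, k) => //; rewrite /F /=; case: ifPn => // /asboolPn[].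
  move=> w bw; apply: beA; split=> // i j; rewrite ord1.
  rewrite /ball/= (splitr e) -(subrKA (ratr (q ord0 j))).
  rewrite (le_lt_trans (ler_normD _ _))// ltrD// ?(lt_trans _ ke)//.
  by rewrite distrC.
by apply: countable_bigcupT_measurable => //; exact: countableP.
Qed.

End measurable_rV.

Section lebesgue_measure_cons.
Context {R : realType} (n : nat).
Variable mu : {sigma_finite_measure set 'rV[R]_n -> \bar R}.

Definition consV (p : R * 'rV[R]_n) : 'rV[R]_n.+1 := row_mx p.1%:M p.2.

Lemma consV0 p : consV p ord0 ord0 = p.1.
Proof.
have -> : @ord0 n = @lshift 1 n ord0 by exact/val_inj.
by rewrite [LHS]row_mxEl mxE eqxx.
Qed.

Lemma consV_lift p (i : 'I_n) : consV p ord0 (lift ord0 i) = p.2 ord0 i.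
Proof.
have -> : lift ord0 i = @rshift 1 n i by exact/val_inj.
by rewrite [LHS]row_mxEr.
Qed.

Lemma measurable_consV : measurable_fun [set: R * 'rV[R]_n] consV.
Proof.
apply: measurable_fun_rV => i; have [j ->|->] := unliftP ord0 i.
  under eq_fun do rewrite consV_lift.
  exact: (measurableT_comp (measurable_coord j) measurable_snd).
by under eq_fun do rewrite consV0; exact: measurable_fst.
Qed.

HB.instance Definition _ := isMeasurableFun.Build _ _ _ _ consV measurable_consV.

Definition lebesgue_cons : set 'rV[R]_n.+1 -> \bar R :=
  pushforward (lebesgue_measure \x mu)%E consV.

Let pf := measure_function_pushforward__canonical__measure_function_Measure
  (lebesgue_measure \x mu)%E measurable_consV.

Let lebesgue_cons0 : lebesgue_cons set0 = 0%E.
Proof. exact: (@measure0 _ _ _ pf). Qed.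

Let lebesgue_cons_ge0 A : (0 <= lebesgue_cons A)%E.
Proof. exact: (@measure_ge0 _ _ _ pf). Qed.

Let lebesgue_cons_sigma_additive : semi_sigma_additive lebesgue_cons.
Proof. exact: (@measure_semi_sigma_additive _ _ _ pf). Qed.

HB.instance Definition _ := isMeasure.Build _ _ _ lebesgue_cons
  lebesgue_cons0 lebesgue_cons_ge0 lebesgue_cons_sigma_additive.

Let unconsV (v : 'rV[R]_n.+1) : R * 'rV[R]_n :=
  (v ord0 ord0, \row_i v ord0 (lift ord0 i)).

Let consVK : cancel consV unconsV.
Proof.
move=> p; rewrite /unconsV consV0 [p in RHS]surjective_pairing; congr pair.
by apply/rowP => i; rewrite mxE consV_lift.
Qed.

Let measurable_unconsV : measurable_fun setT unconsV.
Proof.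
apply: measurable_fun_pair => /=; first exact: measurable_coord.
apply: measurable_fun_rV => i; under eq_fun do rewrite mxE.
exact: measurable_coord.
Qed.

Lemma lebesgue_consE (A : set R) (B : set 'rV[R]_n) :
  measurable A -> measurable B ->
  lebesgue_cons [set v | A (v ord0 ord0) /\ B (\row_i v ord0 (lift ord0 i))] =
  (lebesgue_measure A * mu B)%E.
Proof.
move=> mA mB; rewrite -product_measure1E//.
rewrite /lebesgue_cons /pushforward; congr (_ _).
have p2E p : \row_i consV p ord0 (lift ord0 i) = p.2.
  by apply/rowP => i; rewrite mxE consV_lift.
by apply/seteqP; split=> p /=; rewrite consV0 p2E.
Qed.

Let lebesgue_cons_sigma_finite : sigma_finite setT lebesgue_cons.
Proof.
have /sigma_finiteP[F [TF ndF Foo]] := sigma_finiteT (@lebesgue_measure R).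
have /sigma_finiteP[G [TG ndG Goo]] := sigma_finiteT mu.
exists (fun k => unconsV @^-1` (F k `*` G k)).
  rewrite -preimage_bigcup -[LHS](preimage_setT unconsV); congr preimage.
  rewrite -setXTT TF TG predeqE => -[x y]; split.
    move=> [/= [k _ Fkx] [l _ Gly]]; exists (maxn k l) => //; split.
    - by move: x Fkx; exact/subsetPset/ndF/leq_maxl.
    - by move: y Gly; exact/subsetPset/ndG/leq_maxr.
  by move=> [k _ []/= ? ?]; split; exists k.
move=> k; have [? ?] := Foo k; have [? ?] := Goo k; split.
  by rewrite -[X in measurable X]setTI; apply: measurable_unconsV => //; exact: measurableX.
rewrite [X in lebesgue_cons X](_ : _ = [set v : 'rV[R]_n.+1 |
  F k (v ord0 ord0) /\ G k (\row_i v ord0 (lift ord0 i))])//.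
by rewrite lebesgue_consE// lte_mul_pinfty// ge0_fin_numE.
Qed.

HB.instance Definition _ := @Measure_isSigmaFinite.Build _ _ _
  lebesgue_cons lebesgue_cons_sigma_finite.

End lebesgue_measure_cons.

Fixpoint lebesgue_rV {R : realType} n :
    {sigma_finite_measure set 'rV[R]_n -> \bar R} :=
  match n return {sigma_finite_measure set 'rV[R]_n -> \bar R} with
  | 0 => dirac (0 : 'rV[R]_0)
  | n'.+1 => lebesgue_cons (lebesgue_rV n')
  end.

Section semi_inner_product.
Context {R : realType} {V : lmodType R} (B : V -> V -> R).
Hypothesis BC : forall x y, B x y = B y x.
Hypothesis BDl : forall x y z, B (x + y) z = B x z + B y z.
Hypothesis BZl : forall a x y, B (a *: x) y = a * B x y.
Hypothesis B_ge0 : forall x, 0 <= B x x.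

Lemma cauchy_schwarz x y : B x y ^+ 2 <= B x x * B y y.
Proof.
have BE a b : B (a *: x + b *: y) (a *: x + b *: y) =
    a ^+ 2 * B x x + 2 * a * b * B x y + b ^+ 2 * B y y.
  rewrite BDl !BZl ![B _ (_ + _)]BC !BDl !BZl [B y x]BC; ring.
have [yy0|yy0] := eqVneq (B y y) 0; last first.
  have yy : 0 < B y y by rewrite lt_neqAle eq_sym yy0 B_ge0.
  have := B_ge0 (B y y *: x + (- B x y) *: y); rewrite BE.
  rewrite (_ : _ + _ + _ = B y y * (B x x * B y y - B x y ^+ 2)); last by ring.
  by rewrite pmulr_rge0// subr_ge0.
rewrite yy0 mulr0; have [->|xy0] := eqVneq (B x y) 0; first by rewrite expr0n.
have := B_ge0 (1 *: x + (- (B x x + 1) / (2 * B x y)) *: y).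
rewrite BE yy0 mulr0 addr0.
rewrite (_ : _ + _ = - 1); last by field.
by rewrite oppr_ge0 ler10.
Qed.

Lemma sqrt_triangle x y :
  Num.sqrt (B (x + y) (x + y)) <= Num.sqrt (B x x) + Num.sqrt (B y y).
Proof.
rewrite -(ler_pXn2r (ltn0Sn 1)) ?nnegrE ?addr_ge0 ?sqrtr_ge0//.
rewrite sqr_sqrtr// sqrrD !sqr_sqrtr// BDl ![B _ (_ + _)]BC !BDl [B y x]BC.
have : B x y <= Num.sqrt (B x x) * Num.sqrt (B y y).
  rewrite -sqrtrM// (le_trans (ler_norm _))// -sqrtr_sqr ler_wsqrtr//.
  exact: cauchy_schwarz.
lra.
Qed.

Lemma sqrt_homogeneous a x :
  Num.sqrt (B (a *: x) (a *: x)) = `|a| * Num.sqrt (B x x).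
Proof. by rewrite BZl BC BZl mulrA -expr2 sqrtrM ?sqr_ge0// sqrtr_sqr. Qed.

End semi_inner_product.

Section test_functions.
Context {R : realType} {n : nat}.
Implicit Types (Om : set 'rV[R]_n) (phi : 'rV[R]_n -> R) (i : 'I_n).

Definition partial i phi : 'rV[R]_n -> R := 'D_(delta_mx 0 i) phi.

Definition smooth phi :=
  forall (s : seq 'I_n) x, differentiable (foldr partial phi s) x.

Definition test_function Om phi :=
  let supp := closure [set x | phi x != 0] in
  [/\ smooth phi, compact supp & supp `<=` Om].

End test_functions.

Section test_functions_theory.
Context {R : realType} {n : nat}.
Implicit Types (Om : set 'rV[R]_n) (phi psi : 'rV[R]_n -> R) (i : 'I_n).

Lemma smooth_iter phi s : smooth phi -> smooth (foldr partial phi s).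
Proof. by move=> sphi t x; rewrite -foldr_cat; exact: sphi. Qed.

Lemma iter_partial_linear (a : R) phi psi s : smooth phi -> smooth psi ->
  foldr partial (a \*: phi \+ psi) s =
  a \*: foldr partial phi s \+ foldr partial psi s.
Proof.
move=> sphi spsi; elim: s => [//|i s /= ->]; apply/funext => x.
have dphi := diff_derivable (sphi s x).
have dpsi := diff_derivable (spsi s x).
rewrite /partial deriveD//; first by rewrite deriveZ.
exact: derivableZ.
Qed.

Lemma test_function_linear (a : R) Om phi psi :
  test_function Om phi -> test_function Om psi ->
  test_function Om (a \*: phi \+ psi).
Proof.
move=> [sphi cphi phiO] [spsi cpsi psiO].
have sub : closure [set x | (a \*: phi \+ psi) x != 0] `<=`
    closure [set x | phi x != 0] `|` closure [set x | psi x != 0].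
  rewrite -closureU; apply: closureS => x /=; apply: contra_neqP.
  move=> /not_orP[/negP/negbNE/eqP -> /negP/negbNE/eqP ->].
  by rewrite scaler0 addr0.
split.
- move=> s x; rewrite iter_partial_linear//.
  by apply: differentiableD; [apply: differentiableZ|]; [exact: sphi|exact: spsi].
- apply: subclosed_compact (compactU cphi cpsi) sub.
  exact: closed_closure.
- by move=> x /sub[/phiO|/psiO].
Qed.

Lemma test_function0 Om : test_function Om (cst 0 : 'rV[R]_n -> R).
Proof.
have e0 : [set x : 'rV[R]_n | (cst 0 x : R) != 0] = set0.
  by apply/seteqP; split=> x //=; rewrite eqxx.
rewrite /test_function e0 closure0; split=> //; last exact: compact0.
move=> s x; have -> : foldr partial (cst 0) s = cst 0 :> ('rV[R]_n -> R).
  by elim: s => [//|i s /= ->]; apply/funext => y; rewrite /partial derive_cst.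
exact: differentiable_cst.
Qed.

Lemma supp_partial phi i :
  [set x | partial i phi x != 0] `<=` closure [set x | phi x != 0].
Proof.
move=> x; apply: contra_neqP => nx.
have /open_nbhs_nbhs phi0 : open_nbhs x (~` closure [set x | phi x != 0]).
  by split=> //; apply: closed_openC; exact: closed_closure.
rewrite /partial (@near_eq_derive _ _ _ phi (cst 0)) ?derive_cst//.
near=> y; apply/eqP/negPn/negP => y0.
have : (~` closure [set x | phi x != 0]) y by near: y.
by apply; exact: subset_closure.
Unshelve. all: by end_near. Qed.

Lemma continuous_measurable_rV phi :
  continuous phi -> measurable_fun [set: 'rV[R]_n] phi.
Proof.
move=> /continuousP cf; apply: (measurability _ (RGenOpens.measurableE R)).
move=> _ [_ [a [b ->] <-]]; rewrite setTI; apply: open_measurable_rV.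
exact/cf/interval_open.
Qed.

Lemma measurable_compact_rV (K : set 'rV[R]_n) : compact K -> measurable K.
Proof.
move=> cK; rewrite -(setCK K); apply: measurableC; apply: open_measurable_rV.
by apply: closed_openC; apply: compact_closed => //; exact: norm_hausdorff.
Qed.

End test_functions_theory.

Section lebesgue_rV_compact.
Context {R : realType}.

Let box m (M : R) : set 'rV[R]_m := [set v | forall i, `|v ord0 i| <= M].

Let measurable_box m M : measurable (@box m M).
Proof.
rewrite (_ : @box _ _ = \big[setI/setT]_(i < m)
  ((fun v : 'rV[R]_m => v ord0 i) @^-1` `[- M, M]%classic)); last first.
  apply/seteqP; split => v.
    by move=> bv; rewrite -bigcap_seq => i _ /=; rewrite in_itv/= -ler_norml.
  rewrite -bigcap_seq => h i; rewrite ler_norml.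
  by have /= := h i; rewrite in_itv/=; apply; rewrite mem_index_enum.
apply: bigsetI_measurable => i _.
by rewrite -[X in measurable X]setTI; exact: measurable_coord.
Qed.

Let lebesgue_box m M : (lebesgue_rV m (@box m M) < +oo)%E.
Proof.
elim: m => [|m IHm] /=; first by rewrite diracE ltry.
apply: (@le_lt_trans _ _ (lebesgue_cons (lebesgue_rV m)
  [set v : 'rV[R]_m.+1 | `[- M, M]%classic (v ord0 ord0) /\
    @box m M (\row_i v ord0 (lift ord0 i))])); last first.
  rewrite lebesgue_consE//.
  rewrite lte_mul_pinfty// lebesgue_measure_itv/=; by case: ifPn.
rewrite le_eqVlt; apply/orP; left; apply/eqP; congr (lebesgue_cons _ _).
apply/seteqP; split => v.
  move=> bv; split; first by rewrite /= in_itv/= -ler_norml.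
  by move=> i; rewrite mxE.
move=> [/=]; rewrite in_itv/= -ler_norml => v0 bv i.
have [j ->|->//] := unliftP ord0 i.
by have := bv j; rewrite mxE.
Qed.

Lemma compact_lebesgue_rV n (K : set 'rV[R]_n) :
  compact K -> (lebesgue_rV n K < +oo)%E.
Proof.
move=> cK; have [M [_ /(_ (M + 1))]] := compact_bounded cK.
rewrite ltrDl ltr01 => /(_ isT) KM.
apply: le_lt_trans (lebesgue_box n (M + 1)).
apply: le_measure; rewrite ?inE//; first exact: measurable_compact_rV.
  exact: measurable_box.
move=> v /KM; rewrite /= [`|v|]mx_normrE => vM i.
apply: le_trans vM; apply/bigmax_geP; right => /=.
by exists (ord0, i).
Qed.

End lebesgue_rV_compact.

Section L2_space.
Context {R : realType} {n : nat} {Om : set 'rV[R]_n} (oOm : open Om).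

Definition lebesgue_on : set 'rV[R]_n -> \bar R :=
  mrestr (lebesgue_rV n) (open_measurable_rV oOm).
HB.instance Definition _ := Measure.on lebesgue_on.

Local Notation L2 := (LfunType lebesgue_on (lee1n 2)).
Local Notation dx := lebesgue_on.

Lemma integrable_L2_mul (f g : L2) :
  dx.-integrable setT (EFin \o (fun x => f x * g x)).
Proof. by apply/Lfun1_integrable/Lfun2_mul_Lfun1; exact: LfunP. Qed.

Lemma Lfun2_compact_support (f : 'rV[R]_n -> R) (K : set 'rV[R]_n) :
  continuous f -> compact K -> (forall x, ~ K x -> f x = 0) ->
  f \in Lfun dx 2%:E.
Proof.
move=> cf cK fK0.
have mf : measurable_fun setT f by exact: continuous_measurable_rV.
have mK := measurable_compact_rV cK.
have : dx.-integrable setT (EFin \o (fun x => f x ^+ 2)).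
  rewrite (_ : _ \o _ = (EFin \o (fun x => f x ^+ 2)) \_ K); last first.
    apply/funext => x; rewrite patchE; case: ifPn => //.
    by rewrite notin_setE => /fK0 /= ->; rewrite expr0n.
  apply: (integrable_mkcond _ mK).1; apply: measurable_bounded_integrable => //.
  - apply: le_lt_trans (compact_lebesgue_rV cK).
    rewrite /lebesgue_on /mrestr; apply: le_measure; rewrite ?inE//.
    by apply: measurableI => //; exact: open_measurable_rV.
  - by apply: measurable_funTS; exact: measurable_funX.
  - have : compact (f @` K).
      by apply: continuous_compact => //; exact: continuous_subspaceT.
    move=> /compact_bounded[M [_ /(_ (`|M| + 1))]].
    rewrite (le_lt_trans (ler_norm M)) ?ltrDl// => /(_ isT) fM.
    exists ((`|M| + 1) ^+ 2); split; first by rewrite ger0_real// sqr_ge0.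
    move=> y My x Kx /=; rewrite (le_trans _ (ltW My))// normrX.
    rewrite ler_pXn2r ?nnegrE ?addr_ge0//.
    by apply: fM; exists x.
move=> /integrableP[_ foo].
apply/andP; split; rewrite inE//=.
rewrite /finite_norm unlock/= poweR_lty//.
apply: le_lt_trans foo; apply: ge0_le_integral => //=.
- apply/measurable_EFinP.
  apply: (@measurableT_comp _ _ _ _ _ _ (fun x : R => x `^ 2)) => //.
  exact: measurableT_comp.
- apply/measurable_EFinP; apply: measurableT_comp => //.
  exact: measurable_funX.
- by move=> x _; rewrite lee_fin normrX powR_mulrn.
Qed.

Lemma test_function_Lfun2 phi s :
  test_function Om phi -> foldr partial phi s \in Lfun dx 2%:E.
Proof.
move=> [sphi cphi _]; apply: (Lfun2_compact_support _ cphi).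
  by move=> x; apply: differentiable_continuous; exact: sphi.
have supp : [set x | foldr partial phi s x != 0] `<=`
    closure [set x | phi x != 0].
  elim: s => [|i s IHs] /=; first exact: subset_closure.
  apply: subset_trans (@supp_partial _ _ _ i) _.
  rewrite [X in _ `<=` X]((closure_id (closure [set x | phi x != 0])).1 _).
    exact: closureS.
  exact: closed_closure.
by move=> x nx; apply: contra_notP nx => /eqP; exact: supp.
Qed.

Lemma integrable_L2_test (f : L2) phi s : test_function Om phi ->
  dx.-integrable setT (EFin \o (fun x => f x * foldr partial phi s x)).
Proof.
move=> tphi; apply/Lfun1_integrable/Lfun2_mul_Lfun1; first exact: LfunP.
exact: test_function_Lfun2.
Qed.

End L2_space.

Section L2_pairs.
Context {R : realType} {n : nat} {Om : set 'rV[R]_n} (oOm : open Om).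

Local Notation L2 := (LfunType (lebesgue_on oOm) (lee1n 2)).
Local Notation dx := (lebesgue_on oOm).
Local Notation V := (L2 * {ffun 'I_n -> L2})%type.

Definition pair_ip (x y : V) : R :=
  \int[dx]_t (x.1 t * y.1 t + \sum_i x.2 i t * y.2 i t).

Let intsum (x y : V) :
  dx.-integrable setT (EFin \o (fun t => \sum_i x.2 i t * y.2 i t)).
Proof.
rewrite (_ : _ \o _ = fun t => (\sum_i (x.2 i t * y.2 i t)%:E)%E); last first.
  by apply/funext => t /=; rewrite sumEFin.
by apply: integrable_sum => // i _; exact: integrable_L2_mul.
Qed.

Let int_ip (x y : V) : dx.-integrable setT
  (EFin \o (fun t => x.1 t * y.1 t + \sum_i x.2 i t * y.2 i t)).
Proof.
apply: (@integrableD _ _ _ dx setT measurableT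
  (EFin \o (fun t => x.1 t * y.1 t))) (intsum x y).
exact: integrable_L2_mul.
Qed.

Lemma pair_ipC x y : pair_ip x y = pair_ip y x.
Proof.
apply: eq_Rintegral => t _; rewrite mulrC; congr +%R.
by apply: eq_bigr => i _; rewrite mulrC.
Qed.

Lemma pair_ipDl x y z : pair_ip (x + y) z = pair_ip x z + pair_ip y z.
Proof.
rewrite -RintegralD//; apply: eq_Rintegral => t _ /=.
rewrite mulrDl addrACA; congr (_ + _).
by rewrite -big_split/=; apply: eq_bigr => i _; rewrite ffunE mulrDl.
Qed.

Lemma pair_ipZl a x y : pair_ip (a *: x) y = a * pair_ip x y.
Proof.
rewrite -RintegralZl//; apply: eq_Rintegral => t _ /=.
rewrite mulrDr mulr_sumr mulrA; congr (_ + _).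
by apply: eq_bigr => i _; rewrite ffunE mulrA.
Qed.

Lemma pair_ip_ge0 x : 0 <= pair_ip x x.
Proof.
apply: Rintegral_ge0 => t _; rewrite addr_ge0 -?expr2 ?sqr_ge0//.
by apply: sumr_ge0 => i _; rewrite -expr2 sqr_ge0.
Qed.

Definition pair_ae_eq (x y : V) : bool :=
  `[< \forall t \ae dx, x.1 t = y.1 t /\ forall i, x.2 i t = y.2 i t >].

Let pair_ae_eq_refl : reflexive pair_ae_eq.
Proof. by move=> x; apply/asboolP; apply: aeW. Qed.

Let pair_ae_eq_sym : symmetric pair_ae_eq.
Proof.
suff h x y : pair_ae_eq x y -> pair_ae_eq y x by move=> x y; apply/idP/idP; exact: h.
move=> /asboolP xy; apply/asboolP; apply: filterS xy => t [-> xy].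
by split=> // i; rewrite xy.
Qed.

Let pair_ae_eq_trans : transitive pair_ae_eq.
Proof.
move=> y x z /asboolP xy /asboolP yz; apply/asboolP.
by apply: filterS2 xy yz => t [-> xy] [-> yz]; split=> // i; rewrite xy yz.
Qed.

Canonical pair_ae_eq_equiv :=
  EquivRel pair_ae_eq pair_ae_eq_refl pair_ae_eq_sym pair_ae_eq_trans.

Lemma pair_ae_eq_linear a x x' y y' : pair_ae_eq x x' -> pair_ae_eq y y' ->
  pair_ae_eq (a *: x + y) (a *: x' + y').
Proof.
move=> /asboolP xx' /asboolP yy'; apply/asboolP.
apply: filterS2 xx' yy' => t [x1 x2] [y1 y2]; split=> [|i].
  by rewrite -[LHS]/(a * x.1 t + y.1 t) x1 y1.
by rewrite !ffunE -[LHS]/(a * x.2 i t + y.2 i t) x2 y2.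
Qed.

Lemma pair_ip_ae_eq x x' y : pair_ae_eq x x' -> pair_ip x y = pair_ip x' y.
Proof.
move=> /asboolP xx'; congr fine; apply: ae_eq_integral => //.
- by case/integrableP: (int_ip x y).
- by case/integrableP: (int_ip x' y).
apply: filterS xx' => t [x1 x2] _ /=; rewrite x1; congr (_ + _)%:E.
by apply: eq_bigr => i _; rewrite x2.
Qed.

Lemma pair_ip_eq0 x : pair_ip x x = 0 -> pair_ae_eq x 0.
Proof.
have ge0 t : 0 <= \sum_i x.2 i t * x.2 i t.
  by apply: sumr_ge0 => i _; rewrite -expr2 sqr_ge0.
move=> xx0; apply/asboolP.
have /integrableP[mxx _] := int_ip x x.
have /ae_eq_integral_abs : (\int[dx]_t `|(x.1 t * x.1 t +
    \sum_i x.2 i t * x.2 i t)%:E| = 0)%E.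
  rewrite (eq_integral (EFin \o (fun t => x.1 t * x.1 t +
    \sum_i x.2 i t * x.2 i t))); last first.
    by move=> t _ /=; rewrite ger0_norm// addr_ge0// -expr2 sqr_ge0.
  by rewrite -[LHS]fineK ?integrable_fin_num//; congr (_%:E).
move=> /(_ measurableT mxx); apply: filterS => t /(_ I) /= [] /eqP.
rewrite paddr_eq0// -?expr2 ?sqr_ge0// sqrf_eq0 => /andP[/eqP -> /eqP x20].
split=> // i; rewrite ffunE/=; apply/eqP.
rewrite -sqrf_eq0 expr2; apply/eqP.
apply: (psumr_eq0P _ x20) => // j _.
by rewrite -expr2 sqr_ge0.
Qed.

Local Open Scope quotient_scope.

Definition L2_pair : Type := {eq_quot pair_ae_eq}.
HB.instance Definition _ := Choice.on L2_pair.
HB.instance Definition _ := EqQuotient.on L2_pair.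

Let pi (x : V) : L2_pair := \pi x.
Let rep (w : L2_pair) : V := repr w.

Let pi_eq x y : pair_ae_eq x y -> pi x = pi y.
Proof. by move=> xy; exact/eqmodP. Qed.

Let rep_pi x : pair_ae_eq (rep (pi x)) x.
Proof. by apply/eqmodP; rewrite reprK. Qed.

Let pi_rep w : pi (rep w) = w. Proof. exact: reprK. Qed.

Let comb a (v w : L2_pair) := pi (a *: rep v + rep w).

Let pi_comb a x y : comb a (pi x) (pi y) = pi (a *: x + y).
Proof. by apply: pi_eq; exact: pair_ae_eq_linear. Qed.

Let zero := pi 0.
Let add := comb 1.
Let scale a v := comb a v zero.
Let opp := scale (-1).

Let piD x y : add (pi x) (pi y) = pi (x + y).
Proof. by rewrite /add pi_comb scale1r. Qed.

Let piZ a x : scale a (pi x) = pi (a *: x).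
Proof. by rewrite /scale pi_comb addr0. Qed.

Let addA : associative add.
Proof.
by move=> u v w; rewrite -(pi_rep u) -(pi_rep v) -(pi_rep w) !piD addrA.
Qed.

Let addC : commutative add.
Proof. by move=> u v; rewrite -(pi_rep u) -(pi_rep v) !piD addrC. Qed.

Let add0 : left_id zero add.
Proof. by move=> u; rewrite -(pi_rep u) piD add0r. Qed.

Let addN : left_inverse zero opp add.
Proof. by move=> u; rewrite /opp -(pi_rep u) piZ piD scaleN1r addNr. Qed.

HB.instance Definition _ := GRing.isZmodule.Build L2_pair addA addC add0 addN.

Let scaleA a b v : scale a (scale b v) = scale (a * b) v.
Proof. by rewrite -(pi_rep v) !piZ scalerA. Qed.

Let scale1 : left_id 1 scale.
Proof. by move=> v; rewrite -(pi_rep v) piZ scale1r. Qed.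

Let scaleDr : right_distributive scale +%R.
Proof.
move=> a u v; rewrite -[LHS]/(scale a (add u v)).
rewrite -[RHS]/(add (scale a u) (scale a v)) -(pi_rep u) -(pi_rep v).
by rewrite piD !piZ piD scalerDr.
Qed.

Let scaleDl v : {morph scale^~ v : a b / a + b}.
Proof. move=> a b; rewrite -[RHS]/(add (scale a v) (scale b v)) -(pi_rep v).
by rewrite !piZ piD scalerDl. Qed.

HB.instance Definition _ := GRing.Zmodule_isLmodule.Build R L2_pair
  scaleA scale1 scaleDr scaleDl.

Lemma repr_linear a (v w : L2_pair) :
  pair_ae_eq (repr (a *: v + w)) (a *: repr v + repr w).
Proof.
have -> : a *: v + w = pi (a *: rep v + rep w).
  rewrite -[LHS]/(add (scale a v) w) -[v in LHS]pi_rep -[w in LHS]pi_rep.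
  by rewrite piZ piD.
exact: rep_pi.
Qed.

Definition L2_pair_ip (v w : L2_pair) : R := pair_ip (repr v) (repr w).

Lemma L2_pair_ipC v w : L2_pair_ip v w = L2_pair_ip w v.
Proof. exact: pair_ipC. Qed.

Let ip_linear a u v w :
  L2_pair_ip (a *: u + v) w = a * L2_pair_ip u w + L2_pair_ip v w.
Proof.
by rewrite /L2_pair_ip (pair_ip_ae_eq _ (repr_linear a u v)) pair_ipDl pair_ipZl.
Qed.

Let repr0 : pair_ae_eq (repr (0 : L2_pair)) 0.
Proof. exact: rep_pi. Qed.

Lemma L2_pair_ipDl u v w : L2_pair_ip (u + v) w = L2_pair_ip u w + L2_pair_ip v w.
Proof. by rewrite -[u in LHS]scale1r ip_linear mul1r. Qed.

Lemma L2_pair_ipZl a u w : L2_pair_ip (a *: u) w = a * L2_pair_ip u w.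
Proof.
rewrite -[a *: u]addr0 ip_linear /L2_pair_ip (pair_ip_ae_eq _ repr0).
by rewrite -[X in _ + pair_ip X _](scale0r 0) pair_ipZl mul0r addr0.
Qed.

Lemma L2_pair_ip_ge0 w : 0 <= L2_pair_ip w w.
Proof. exact: pair_ip_ge0. Qed.

Let norm0 w : Num.sqrt (L2_pair_ip w w) = 0 -> w = 0.
Proof.
move=> /eqP; rewrite sqrtr_eq0 => w0.
have /pair_ip_eq0 : pair_ip (repr w) (repr w) = 0.
  by apply/eqP; rewrite eq_le w0 pair_ip_ge0.
by move=> /pi_eq; rewrite pi_rep.
Qed.

HB.instance Definition _ := @Lmodule_isNormed.Build R L2_pair
  (fun w => Num.sqrt (L2_pair_ip w w))
  (sqrt_triangle L2_pair_ipC L2_pair_ipDl L2_pair_ipZl L2_pair_ip_ge0)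
  (sqrt_homogeneous L2_pair_ipC L2_pair_ipZl) norm0.

End L2_pairs.

Section sobolev.
Context {R : realType} {n : nat} {Om : set 'rV[R]_n} (oOm : open Om).

Local Notation L2 := (LfunType (lebesgue_on oOm) (lee1n 2)).
Local Notation dx := (lebesgue_on oOm).
Local Notation W := (L2_pair oOm).

Definition weak_gradient (u : L2) (G : {ffun 'I_n -> L2}) :=
  forall phi i, test_function Om phi ->
  \int[dx]_x (u x * partial i phi x) = - \int[dx]_x (G i x * phi x).

Definition H1 : set W := [set w | weak_gradient (repr w).1 (repr w).2].

Definition represents (w : W) (phi : 'rV[R]_n -> R) :=
  \forall x \ae dx, (repr w).1 x = phi x /\
    forall i, (repr w).2 i x = partial i phi x.

Definition H1_test : set W :=
  [set w | H1 w /\ exists2 phi, test_function Om phi & represents w phi].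

Definition H10_pred : {pred W} := mem (H1 `&` closure H1_test).

Let repr0 : pair_ae_eq (repr (0 : W)) 0.
Proof.
have := repr_linear (-1) (0 : W) 0.
by rewrite scaleN1r oppr0 addr0 scaleN1r addNr.
Qed.

Let int_linear (f g h : L2) a phi s : test_function Om phi ->
  (\forall x \ae dx, h x = a * f x + g x) ->
  \int[dx]_x (h x * foldr partial phi s x) =
  a * \int[dx]_x (f x * foldr partial phi s x) +
  \int[dx]_x (g x * foldr partial phi s x).
Proof.
move=> tphi hE; have int1 (k : L2) := integrable_L2_test k s tphi.
have intZ : dx.-integrable setT
    (EFin \o (fun x => a * (f x * foldr partial phi s x))).
  exact: (integrableZl measurableT a (int1 f)).
rewrite -RintegralZl// -RintegralD//.
congr fine; apply: ae_eq_integral => //.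
- by case/integrableP: (int1 h).
- by have /integrableP[] := integrableD measurableT intZ (int1 g).
by apply: filterS hE => x hE _ /=; rewrite hE mulrDl mulrA.
Qed.

Let H1_linear a v w : H1 v -> H1 w -> H1 (a *: v + w).
Proof.
move=> v1 w1 phi i tphi; have /asboolP avw := repr_linear a v w.
have h1 : \forall x \ae dx,
    (repr (a *: v + w)).1 x = a * (repr v).1 x + (repr w).1 x.
  by apply: filterS avw => x [].
have h2 : \forall x \ae dx,
    (repr (a *: v + w)).2 i x = a * (repr v).2 i x + (repr w).2 i x.
  by apply: filterS avw => x [_ /(_ i)]; rewrite !ffunE.
have /= -> := int_linear [:: i] tphi h1; have /= -> := int_linear [::] tphi h2.
by rewrite v1// w1// mulrN opprD.
Qed.

Let H1_test_linear a v w : H1_test v -> H1_test w -> H1_test (a *: v + w).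
Proof.
move=> [v1 [phi tphi vphi]] [w1 [psi tpsi wpsi]]; split; first exact: H1_linear.
exists (a \*: phi \+ psi); first exact: test_function_linear.
have /asboolP avw := repr_linear a v w.
apply: filterS3 avw vphi wpsi => x [h1 h2] [v2 v3] [w2 w3]; split=> [|i].
  by rewrite h1 /= -v2 -w2.
have [sphi _ _] := tphi; have [spsi _ _] := tpsi.
have /(congr1 (@^~ x)) /= -> := iter_partial_linear a [:: i] sphi spsi.
by rewrite h2 !ffunE -v3 -w3.
Qed.

Let int_zero (f : L2) phi s : test_function Om phi ->
  (\forall x \ae dx, f x = 0) ->
  \int[dx]_x (f x * foldr partial phi s x) = 0.
Proof.
move=> tphi f0; have := @int_linear f f f 1 phi s tphi.
suff h : \forall x \ae dx, f x = 1 * f x + f x by move=> /(_ h); lra.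
by apply: filterS f0 => x ->; rewrite mulr0 addr0.
Qed.

Let H1_test0 : H1_test 0.
Proof.
have /asboolP r0 := repr0; split.
  move=> phi i tphi.
  have h1 : \forall x \ae dx, (repr (0 : W)).1 x = 0.
    by apply: filterS r0 => x [].
  have h2 : \forall x \ae dx, (repr (0 : W)).2 i x = 0.
    by apply: filterS r0 => x [_ /(_ i)]; rewrite ffunE.
  have /= -> := int_zero [:: i] tphi h1; have /= -> := int_zero [::] tphi h2.
  by rewrite oppr0.
exists (cst 0); first exact: test_function0.
apply: filterS r0 => x [h1 h2]; split=> [|i]; first by rewrite h1.
by rewrite h2 ffunE /partial derive_cst.
Qed.

Let closure_linear a v w : closure H1_test v -> closure H1_test w ->
  closure H1_test (a *: v + w).
Proof.
move=> cv cw B nB.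
have : (fun z : W * W => a *: z.1 + z.2) @ (v, w) --> a *: v + w.
  by apply: cvgD; [apply: cvgZr; exact: cvg_fst|exact: cvg_snd].
move=> /(_ B nB) [[A1 A2] /= [nA1 nA2] A12].
have [v' [tv A1v]] := cv A1 nA1; have [w' [tw A2w]] := cw A2 nA2.
exists (a *: v' + w'); split; first exact: H1_test_linear.
exact: (A12 (v', w')).
Qed.

Let H10_submod_closed : submod_closed H10_pred.
Proof.
split=> [|a v w]; rewrite !inE.
  by split; [case: H1_test0|exact: subset_closure].
by move=> [v1 v2] [w1 w2]; split; [exact: H1_linear|exact: closure_linear].
Qed.

HB.instance Definition _ := GRing.isSubmodClosed.Build R W H10_pred
  H10_submod_closed.

Record H10 : Type := { H10_val : W ; _ : H10_val \in H10_pred }.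

HB.instance Definition _ := [isSub for H10_val].
HB.instance Definition _ := [Choice of H10 by <:].
HB.instance Definition _ := [SubChoice_isSubLmodule of H10 by <:].

Let norm_eq0 (u : H10) : `|H10_val u| = 0 -> u = 0.
Proof. by move=> /normr0_eq0 u0; apply: val_inj; rewrite [RHS]raddf0; exact: u0. Qed.

Let normD (u v : H10) : `|H10_val (u + v)| <= `|H10_val u| + `|H10_val v|.
Proof. exact: ler_normD. Qed.

Let normZ a (u : H10) : `|H10_val (a *: u)| = `|a| * `|H10_val u|.
Proof. exact: normrZ. Qed.

HB.instance Definition _ := @Lmodule_isNormed.Build R H10
  (fun u => `|H10_val u|) normD normZ norm_eq0.

Definition fn (u : H10) : 'rV[R]_n -> R := (repr (H10_val u)).1.

Definition grad (u : H10) (i : 'I_n) : 'rV[R]_n -> R := (repr (H10_val u)).2 i.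

End sobolev.

(* The Lipschitz sets of the statement are open; [lipschitz_boundary] says that
   near each boundary point the set is, in some orthonormal frame, the strict
   epigraph of a Lipschitz function. *)
Definition lipschitz_boundary {R : realType} {n : nat} (Om : set 'rV[R]_n) :=
  forall x0, (closure Om `\` interior Om) x0 ->
  exists (r L : R) (Q : 'M[R]_n) (i : 'I_n) (gamma : 'rV[R]_n.-1 -> R),
  [/\ 0 < r, Q *m Q^T = 1%:M, L.-lipschitz gamma &
      forall x, ball x0 r x ->
        (Om x <-> gamma (col' i (x *m Q)) < (x *m Q) ord0 i)].

Definition lipschitz_partition {R : realType} {n N : nat} (Om : set 'rV[R]_n)
    (Omi : 'I_N -> set 'rV[R]_n) :=
  [/\ forall i, [/\ open (Omi i), Omi i !=set0 & lipschitz_boundary (Omi i)],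
      trivIset setT Omi,
      forall i, Omi i `<=` Om &
      lebesgue_rV n (Om `\` \bigcup_i Omi i) = 0%E].

Section calculus.
Context {R : realType} {V : normedModType R}.
Implicit Types (e : V -> R) (u v w : V).

Definition d1 e u v : R := 'D_v e u.

Definition d2 e u v w : R := 'D_w (fun x => d1 e x v) u.

(* The last two conditions say that [d2 e u] is the derivative of [d1 e] at [u],
   and that [d2 e] is continuous at [u], for the operator norms. *)
Definition C2 e := forall u,
  [/\ differentiable e u,
      forall v, differentiable (fun x => d1 e x v) u,
      forall eps, 0 < eps -> \forall k \near (0 : V), forall v,
        `|d1 e (u + k) v - d1 e u v - d2 e u v k| <= eps * `|k| * `|v| &
      forall eps, 0 < eps -> \forall k \near (0 : V), forall v w,
        `|d2 e (u + k) v w - d2 e u v w| <= eps * `|v| * `|w|].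

Definition span (A : set V) : set V :=
  [set v | exists k (a : 'I_k -> R) (f : 'I_k -> V),
    (forall i, A (f i)) /\ v = \sum_i a i *: f i].

Definition has_dim (T : set V) (k : nat) :=
  exists b : 'I_k -> V,
    (forall a : 'I_k -> R, \sum_i a i *: b i = 0 -> forall i, a i = 0) /\
    T = span (range b).

End calculus.

Section step_size.
Context {R : realType} {n N : nat} {Om : set 'rV[R]_n} {oOm : open Om}.
Local Notation H := (H10 oOm).
Variable Omi : 'I_N -> set 'rV[R]_n.

(* An element of Lambda is given by the row of its values [lambda_i]. *)
Definition step_fun (lam : 'rV[R]_N) (x : 'rV[R]_n) : R :=
  \sum_i lam ord0 i * \1_(Omi i) x.

Definition Lambda_pos (lam : 'rV[R]_N) := forall i, 0 < lam ord0 i.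

Definition weighted_form (lam : 'rV[R]_N) (g v : H) : R :=
  \int[lebesgue_on oOm]_x
    (step_fun lam x * (\sum_i grad g i x * grad v i x) + fn g x * fn v x).

Definition model (kappa : R) (e : H -> R) (u g : H) : R :=
  kappa / 2 * d2 e u g g - d1 e u g.

Definition tangent_space (g : 'rV[R]_N -> H) (lam : 'rV[R]_N) : set H :=
  span (range (fun l => 'D_l g lam)).

(* [g = g_0] in D'(A), for [A] included in [Om], where the distribution [g_0] is
   [phi |-> e'(u; phi)]; [v] is the test function [phi] viewed in [H]. *)
Definition eq_g0_on (e : H -> R) (u g : H) (A : set 'rV[R]_n) :=
  forall (phi : 'rV[R]_n -> R) (v : H),
  test_function A phi -> represents (H10_val v) phi ->
  \int[lebesgue_on oOm]_x (fn g x * phi x) = d1 e u v.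

End step_size.

(* Main.v *)
Require Import Defs.
From mathcomp Require Import all_boot all_order all_algebra.
From mathcomp Require Import all_classical all_reals all_analysis.
From mathcomp Require Import measurable_realfun.
From mathcomp Require Import ring lra.
Set Implicit Arguments. Unset Strict Implicit. Unset Printing Implicit Defensive.
Import Order.TTheory GRing.Theory Num.Theory.
Import numFieldNormedType.Exports.
Local Open Scope classical_set_scope.
Local Open Scope ring_scope.

(** Write B for the weighted form at [lhat], Q_l(v,w) for the integral of
l grad v . grad w, e'' for [d2 e u], and D l for the derivative of [g] at [lhat]
in the direction l.

Moving [lhat] by t l adds t Q_l to B and leaves the right-hand side alone, so
the difference quotients of the solutions satisfy B(w_t,v) = - Q_l(g_t,v).  By
coercivity of B they are Cauchy as t tends to 0, and because H^1_0 is complete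
they converge, at rate O(t), to the D l that solves B(D l,v) = - Q_l(g,v)
([perturbed_equation_derivative], [H10_complete], [solution_derivative]).
Completeness is essential: the derivative is a limit, and without it the limit
could lie outside H^1_0.  The characterization of D l makes it linear in l, so
that T_u is spanned by the N vectors D e_i ([tangent_spaceE]).

Minimality of the quadratic model along t |-> g(lhat + t l), for t > 0, gives
e''(kappa g - h, D l) >= 0 ([optimality_along_curve]); this uses that e'' is
symmetric, which follows from the symmetry of second differences ([d2_sym]).
Replacing l by -l turns the inequality into an equality, so kappa g - h is
e''-orthogonal to T_u.  Hence P h - P (kappa g) is an element of T_u that is
e''-orthogonal to T_u, and it vanishes by coercivity.

For the lower bound on the dimension, let the combination of the D e_i with
coefficients a_i vanish.  It equals D a, so Q_a(g,v) = 0 for all v.  A test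
function phi supported in the j-th piece sees only the coefficient a_j; if
a_j <> 0, the integral of grad g . grad phi vanishes and the equation solved by
[g] reduces to int g phi = e'(u;phi), i.e. g = g_0 on that piece
([derivative_vanishes_local]).  So the D e_i for which g <> g_0 on the i-th piece
are linearly independent, and an independent subfamily of N vectors extends,
within those N vectors, to a basis of their span ([span_range_has_dim]). *)

(** * Completeness of L^2 for fast Cauchy sequences *)

Lemma sum_half_pow_le2 (R : realType) (K : nat) :
  \sum_(0 <= k < K) (2 ^+ k)^-1 <= 2 :> R.
Proof.
suff -> : \sum_(0 <= k < K) (2 ^+ k)^-1 = 2 - 2 * (2 ^+ K)^-1 :> R.
  by rewrite gerBl mulr_ge0// invr_ge0 exprn_ge0.
elim: K => [|K IH]; first by rewrite big_nil expr0 invr1; ring.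
rewrite big_nat_recr//= IH exprS invfM; field.
by rewrite expf_neq0.
Qed.

(** Summability of 2^k d_k^2 forces that of |d_k|, because by the inequality of
arithmetic and geometric means 2 |d_k| <= 2^k d_k^2 + 2^-k. *)
Lemma cvg_weighted_squares (R : realType) (u : nat -> R) (M : R) :
  (forall K, \sum_(0 <= k < K) 2 ^+ k * (u k - u k.+1) ^+ 2 <= M) -> cvgn u.
Proof.
move=> uM; pose d := telescope u.
have dle k : `|d k| <= (2 ^+ k * (u k - u k.+1) ^+ 2 + (2 ^+ k)^-1) / 2.
  have p2 : 0 < 2 ^+ k :> R by rewrite exprn_gt0.
  rewrite -subr_ge0 (_ : _ - _ = 2 ^+ k * (`|d k| - (2 ^+ k)^-1) ^+ 2 / 2).
    by rewrite divr_ge0// mulr_ge0 ?sqr_ge0// ltW.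
  have -> : (u k - u k.+1) ^+ 2 = `|d k| ^+ 2.
    by rewrite real_normK ?num_real// /d /telescope -sqrrN opprB.
  by field; rewrite gt_eqF.
have -> : u = (fun k => u 0%N + series d k).
  by apply/funext => k; rewrite /d telescopeK /= addrC subrK.
apply: is_cvgD; first exact: is_cvg_cst.
apply: normed_cvg; apply: nondecreasing_is_cvgn.
  by apply: nondecreasing_series => k _ _; exact: normr_ge0.
exists ((M + 2) / 2) => _ [K _ <-] /=.
rewrite /series/= (le_trans (ler_sum _ (fun k _ => dle k)))// -mulr_suml.
by rewrite ler_pM2r// big_split/= lerD// sum_half_pow_le2.
Qed.

Section L2_complete.
Context d (T : measurableType d) (R : realType) (mu : {measure set T -> \bar R}).

Lemma Lfun2_of_square (f : T -> R) : measurable_fun setT f ->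
  (\int[mu]_x (f x ^+ 2)%:E < +oo)%E -> f \in Lfun mu 2%:E.
Proof.
move=> mf foo; apply/andP; split; rewrite inE//=.
rewrite /finite_norm unlock/= poweR_lty//.
apply: le_lt_trans foo; apply: ge0_le_integral => //=.
- apply/measurable_EFinP.
  apply: (@measurableT_comp _ _ _ _ _ _ (fun x : R => x `^ 2)) => //.
  exact: measurableT_comp.
- by apply/measurable_EFinP; exact: measurable_funX.
- by move=> x _; rewrite lee_fin powR_mulrn// real_normK ?num_real.
Qed.

Variables (f : nat -> T -> R) (C : R).
Hypothesis f2 : forall k, f k \in Lfun mu 2%:E.
Hypothesis fC : forall i j, (i <= j)%N ->
  (\int[mu]_x ((f i x - f j x) ^+ 2)%:E <= (C * (4 ^+ i)^-1)%:E)%E.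

Let mf k : measurable_fun setT (f k).
Proof. by have := sub_Lfun_mfun (f2 k); rewrite inE. Qed.

(** The squares (f_k - f_{k+1})^2, weighted by 2^k, have a summable sequence of
integrals, so their sum is integrable and hence finite almost everywhere. *)
Lemma fast_L2_cauchy_ae_cvg : \forall x \ae mu, cvgn (f ^~ x).
Proof.
pose s k x := (2 ^+ k * (f k x - f k.+1 x) ^+ 2)%:E.
have s0 k x : (0 <= s k x)%E by rewrite lee_fin mulr_ge0// ?sqr_ge0// exprn_ge0.
have ms k : measurable_fun setT (s k).
  apply/measurable_EFinP; apply: measurable_funM => //.
  by apply: measurable_funX; exact: measurable_funB.
have mS : measurable_fun setT (fun x => \sum_(k <oo) s k x)%E.
  exact: ge0_emeasurable_sum.
have C0 : 0 <= C.
  have := fC (leqnn 0); rewrite expr0 invr1 mulr1 -lee_fin; apply: le_trans.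
  by apply: integral_ge0 => x _; rewrite lee_fin sqr_ge0.
have : mu.-integrable setT (fun x => \sum_(k <oo) s k x)%E.
  apply/integrableP; split=> //.
  under eq_integral do rewrite gee0_abs ?nneseries_ge0//.
  rewrite integral_nneseries//.
  apply: (@le_lt_trans _ _ (C * 2)%:E); last exact: ltry.
  apply: lime_le; first by apply: is_cvg_nneseries => k _ _; exact: integral_ge0.
  apply: nearW => K.
  apply: (@le_trans _ _ (\sum_(0 <= k < K) (C * (2 ^+ k)^-1)%:E)%E).
    apply: lee_sum => k _; rewrite /s.
    under eq_integral do rewrite EFinM.
    rewrite ge0_integralZl_EFin//.
    - apply: (@le_trans _ _ ((2 ^+ k)%:E * (C * (4 ^+ k)^-1)%:E)%E).
        by apply: lee_wpmul2l; rewrite ?lee_fin ?exprn_ge0//; exact: fC.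
      rewrite -EFinM lee_fin le_eqVlt; apply/orP; left; apply/eqP.
      rewrite (_ : 4 = 2 * 2 :> R); last by ring.
      by rewrite exprMn; field; rewrite expf_neq0.
    - by move=> x _; rewrite lee_fin sqr_ge0.
    - by apply/measurable_EFinP/measurable_funX; exact: measurable_funB.
  rewrite sumEFin lee_fin -mulr_sumr.
  by apply: ler_wpM2l => //; exact: sum_half_pow_le2.
move=> /(integrable_ae measurableT); apply: filterS => x /(_ I) /fineK Sx.
apply: (@cvg_weighted_squares _ _ (fine (\sum_(k <oo) s k x)%E)) => K.
rewrite -lee_fin Sx -sumEFin.
by apply: nneseries_lim_ge => k _ _; exact: s0.
Qed.

(** The case p = 2 of the Riesz-Fischer theorem, for sequences with a geometric
rate.  The limit superior is a limit almost everywhere and is measurable without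
any choice on the exceptional set; Fatou's lemma bounds its distance to f_i by
that of the f_j with j >= i. *)
Lemma L2_complete : exists2 F, F \in Lfun mu 2%:E &
  forall i, (\int[mu]_x ((f i x - F x) ^+ 2)%:E <= (C * (4 ^+ i)^-1)%:E)%E.
Proof.
pose F x := fine (limn_esup (fun k => (f k x)%:E)).
have mF : measurable_fun setT F.
  apply: measurableT_comp => //; apply: measurable_fun_limn_esup => k.
  exact/measurable_EFinP.
have FE : \forall x \ae mu, (f ^~ x) @ \oo --> F x.
  apply: filterS fast_L2_cauchy_ae_cvg => x /cvg_ex[l fl].
  have fl' : (f k x)%:E @[k --> \oo] --> l%:E.
    by apply: cvg_EFin; [exact: nearW | exact: fl].
  by rewrite /F (cvg_limn_einf_sup fl').2.
have bound i : (\int[mu]_x ((f i x - F x) ^+ 2)%:E <= (C * (4 ^+ i)^-1)%:E)%E.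
  pose q j x := ((f i x - f j x) ^+ 2)%:E.
  have q0 j x : (0 <= q j x)%E by rewrite lee_fin sqr_ge0.
  have mq j : measurable_fun setT (q j).
    by apply/measurable_EFinP/measurable_funX; exact: measurable_funB.
  have inf0 x : (0 <= limn_einf (q ^~ x))%E.
    rewrite limn_einf_lim; apply: lime_ge; first exact: is_cvg_einfs.
    by apply: nearW => k; apply: le_ereal_inf_tmp => _ [j _ <-].
  rewrite (@ge0_ae_eq_integral _ _ _ mu setT _ (fun x => limn_einf (q ^~ x)))//.
  - apply: le_trans (fatou mu measurableT mq (fun j x _ => q0 j x)) _.
    apply: le_trans (limn_einf_sup _) _.
    rewrite limn_esup_lim; apply: lime_le; first exact: is_cvg_esups.
    exists i => // k /= ik; apply: ge_ereal_sup => _ [j /= kj <-].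
    by apply: fC; exact: leq_trans kj.
  - apply/measurable_EFinP/measurable_funX; exact: measurable_funB.
  - under eq_fun do rewrite /limn_einf.
    apply: measurableT_comp => //; apply: measurable_fun_limn_esup => j.
    exact: measurableT_comp.
  - by move=> x _; rewrite lee_fin sqr_ge0.
  - apply: filterS FE => x fF _.
    have qF : (q j x @[j --> \oo] --> ((f i x - F x) ^+ 2)%:E)%E.
      apply: cvg_EFin; first exact: nearW.
      have fB : f i x - f j x @[j --> \oo] --> f i x - F x.
        by apply: cvgB => //; exact: cvg_cst.
      by rewrite /comp/=; exact: (cvgM fB fB).
    by rewrite (cvg_limn_einf_sup qF).1.
exists F => //.
have f0F : (fun x => f 0%N x - F x) \in Lfun mu 2%:E.
  apply: Lfun2_of_square; first exact: measurable_funB.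
  exact: le_lt_trans (bound 0%N) (ltry _).
suff -> : F = f 0%N - (fun x => f 0%N x - F x).
  have [_ LD] := @Lfun_addr_closed _ _ _ mu 2%:E (lee1n 2).
  have LN := @Lfun_oppr_closed _ _ _ mu 2%:E.
  by apply: LD => //; exact: LN.
by apply/funext => x; rewrite -[RHS]/(f 0%N x - (f 0%N x - F x)) subKr.
Qed.

End L2_complete.

(** * Bases of the span of a finite family *)

Section finite_span.
Context {R : realType} {V : normedModType R}.

Lemma sub_span (A B : set V) : A `<=` B -> Defs.span A `<=` Defs.span B.
Proof. by move=> AB v [k [a [f [fA ->]]]]; exists k, a, f; split=> // i; exact: AB. Qed.

Lemma span_rangeP (I : finType) (w : I -> V) v :
  Defs.span (range w) v <-> exists a : I -> R, v = \sum_i a i *: w i.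
Proof.
split=> [[k [a [f [fw ->]]]]|[a ->]]; last first.
  exists #|I|, (a \o enum_val), (w \o enum_val).
  by split=> [j|]; [exists (enum_val j)|rewrite [LHS]big_enum_val].
have c i : {j | w j = f i} by apply: cid; case: (fw i) => j _ <-; exists j.
exists (fun j => \sum_(i | sval (c i) == j) a i).
under [RHS]eq_bigr do rewrite scaler_suml.
rewrite (exchange_big_dep predT)//=; apply: eq_bigr => i _.
by rewrite (big_pred1 (sval (c i))) ?(svalP (c i))// => j; rewrite eq_sym.
Qed.

Lemma sub_span_range (I : finType) (w : I -> V) (A : set V) :
  A `<=` Defs.span (range w) -> Defs.span A `<=` Defs.span (range w).
Proof.
move=> Aw v [k [a [f [fA ->]]]].
have c i : {b : I -> R | f i = \sum_j b j *: w j}.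
  by apply: cid; apply/span_rangeP/Aw/fA.
apply/span_rangeP; exists (fun j => \sum_i a i * sval (c i) j).
under [RHS]eq_bigr do rewrite scaler_suml.
rewrite exchange_big/=; apply: eq_bigr => i _.
by rewrite [in LHS](svalP (c i)) scaler_sumr; apply: eq_bigr => j _; rewrite scalerA.
Qed.

(** Coefficients are indexed by all of [I] and vanish outside [S], so that no
subfamily has to be reindexed. *)
Definition independent_on (I : finType) (w : I -> V) (S : {set I}) :=
  forall a : I -> R, (forall i, i \notin S -> a i = 0) ->
  \sum_i a i *: w i = 0 -> forall i, a i = 0.

(** If [w j] were not a combination of the family indexed by [S], adding [j] to [S]
would keep the family independent. *)
Lemma maximal_independent_spans (I : finType) (w : I -> V) (S : {set I}) :
  maxset (fun S => `[< independent_on w S >]) S ->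
  forall j, exists2 a : I -> R, (forall i, i \notin S -> a i = 0) &
    w j = \sum_i a i *: w i.
Proof.
move=> /maxsetP[/asboolP indS maxS] j; have [jS|jS] := boolP (j \in S).
  exists (fun i => (i == j)%:R) => [i|].
    by apply: contraNeq; have [->|] := eqVneq i j; rewrite ?eqxx.
  rewrite (bigD1 j)//= eqxx scale1r big1 ?addr0// => i /negbTE ->.
  by rewrite scale0r.
have : ~ independent_on w (j |: S).
  move=> /asboolP /maxS /(_ (finset.subsetUr _ _)) jSS.
  by rewrite -jSS finset.setU11 in jS.
move=> /existsNP[a /not_implyP[aS /not_implyP[a0 /existsNP[i /eqP ai]]]].
have aj : a j != 0.
  apply: contra_neq ai => aj; apply: indS i => // i iS.
  have [->//|ij] := eqVneq i j.
  by apply: aS; rewrite finset.in_setU1 negb_or ij.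
exists (fun i => if i == j then 0 else - (a j)^-1 * a i).
  move=> k kS; case: ifPn => // kj.
  by rewrite (aS k) ?mulr0// finset.in_setU1 negb_or kj.
rewrite (bigD1 j)//= eqxx scale0r add0r.
rewrite (eq_bigr (fun i => - (a j)^-1 *: (a i *: w i))); last first.
  by move=> k /negbTE ->; rewrite scalerA.
move: a0; rewrite (bigD1 j)//= -scaler_sumr => /eqP; rewrite addrC addr_eq0.
by move=> /eqP ->; rewrite scalerN scaleNr opprK scalerA mulVf// scale1r.
Qed.

(** The basis is the subfamily indexed by a maximal independent set containing [D]. *)
Lemma span_range_has_dim N (w : 'I_N -> V) (D : {set 'I_N}) :
  independent_on w D ->
  exists k, [/\ has_dim (Defs.span (range w)) k, (#|D| <= k)%N & (k <= N)%N].
Proof.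
move=> /asboolP indD.
have [S maxS DS] := maxset_exists (P := fun S => `[< independent_on w S >]) indD.
have /maxsetP[/asboolP indS _] := maxS.
exists #|S|; split; last 2 first.
- exact: subset_leq_card.
- by rewrite -[leqRHS]card_ord max_card.
pose b (k : 'I_#|S|) := w (enum_val k).
have extend (a : 'I_#|S| -> R) : \sum_k a k *: b k =
    \sum_i (\sum_(k | enum_val k == i) a k) *: w i.
  under [RHS]eq_bigr do rewrite scaler_suml.
  rewrite [RHS](exchange_big_dep predT)//=; apply: eq_bigr => k _.
  by rewrite (big_pred1 (enum_val k))// => j; rewrite eq_sym.
exists b; split=> [a|].
  rewrite extend => /indS ind k.
  rewrite -[RHS](ind _ (enum_val k)).
    by rewrite (big_pred1 k)// => j; rewrite (inj_eq enum_val_inj).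
  move=> i iS; rewrite big_pred0// => l; apply: contraNF iS => /eqP <-.
  exact: enum_valP.
apply/seteqP; split; last by apply: sub_span => _ [k _ <-]; exists (enum_val k).
apply: sub_span_range => _ [j _ <-]; apply/span_rangeP.
have [a aS ->] := maximal_independent_spans maxS j.
exists (fun k => a (enum_val k)).
rewrite (bigID (mem S))/= [X in _ + X]big1 ?addr0.
  by rewrite big_enum_val.
by move=> i /aS ->; rewrite scale0r.
Qed.

End finite_span.

(** * Bilinearity and symmetry of the second derivative *)

Section second_derivative.
Context {R : realType} {V : normedModType R} (e : V -> R).
Hypothesis e_C2 : C2 e.
Implicit Types (u v w p : V).

Lemma d1_linear u a v w : d1 e u (a *: v + w) = a * d1 e u v + d1 e u w.
Proof. by have [de _ _ _] := e_C2 u; rewrite /d1 !deriveE// linearP. Qed.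

Lemma d2_linearr u v a w w' :
  d2 e u v (a *: w + w') = a * d2 e u v w + d2 e u v w'.
Proof. by have [_ de _ _] := e_C2 u; rewrite /d2 !deriveE// linearP. Qed.

Lemma d2_linearl u a v v' w :
  d2 e u (a *: v + v') w = a * d2 e u v w + d2 e u v' w.
Proof.
have [_ de _ _] := e_C2 u; rewrite /d2.
have -> : (fun x => d1 e x (a *: v + v')) = a \*: (d1 e ^~ v) \+ (d1 e ^~ v').
  by apply/funext => x; rewrite d1_linear.
have dv z : derivable (d1 e ^~ z) u w by exact: diff_derivable.
by rewrite deriveD ?deriveZ//; exact: derivableZ.
Qed.

Lemma is_derive_line p v (t : R) :
  is_derive t 1 (fun a => e (p + a *: v)) (d1 e (p + t *: v) v).
Proof.
have E : (fun h : R => h^-1 *: (((fun a => e (p + a *: v)) \o shift t) (h *: 1)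
    - e (p + t *: v))) =
  (fun h : R => h^-1 *: ((e \o shift (p + t *: v)) (h *: v) - e (p + t *: v))).
  apply/funext => h /=; congr (_ *: (e _ - _)).
  by rewrite [h *: 1]mulr1 scalerDl addrCA.
have [de _ _ _] := e_C2 (p + t *: v).
split; last by rewrite /d1 /derive E.
by rewrite /derivable E; exact: diff_derivable.
Qed.

Definition second_difference u v w (s : R) :=
  e (u + s *: w + s *: v) - e (u + s *: v) - (e (u + s *: w) - e u).

Lemma second_differenceC u v w s :
  second_difference u v w s = second_difference u w v s.
Proof. by rewrite /second_difference (addrAC u); ring. Qed.

Lemma second_difference_MVT u v w (s : R) : 0 < s -> exists2 c, 0 < c < s &
  second_difference u v w s =
  s * (d1 e (u + s *: w + c *: v) v - d1 e (u + c *: v) v).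
Proof.
move=> s0; pose psi a := e (u + s *: w + a *: v) - e (u + a *: v).
have dpsi (t : R) : is_derive t 1 psi
    (d1 e (u + s *: w + t *: v) v - d1 e (u + t *: v) v).
  by apply: is_deriveB; exact: is_derive_line.
have [|c] := MVT s0 (fun t _ => dpsi t).
  apply: derivable_within_continuous => t _.
  exact: (@ex_derive _ _ _ _ _ _ _ (dpsi t)).
rewrite in_itv /= subr0 => cs psiE; exists c => //.
by rewrite mulrC -psiE /psi !scale0r !addr0.
Qed.

(** By the mean value theorem the second difference is s times a difference of
first derivatives at two points within O(s) of [u]; differentiability of [d1 e] at
[u], uniformly in the direction, gives each of them up to o(s). *)
Lemma second_difference_d2 u v w eps : 0 < eps -> \forall s \near 0^'+,
  `|second_difference u v w s - s ^+ 2 * d2 e u v w| <= eps * s ^+ 2.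
Proof.
move=> eps0; have [_ _ de _] := e_C2 u.
(* K bounds (|k1| + |k2|) |v| / s for the two increments k1 and k2 below. *)
set K := (2 * (`|v| + `|w| + 1) * (`|v| + 1)).
have K0 : 0 < K by rewrite !mulr_gt0// ?ltr_wpDl// addr_ge0.
have /nbhs_ballP[r /= r0 /= dr] := de _ (divr_gt0 eps0 K0).
have bnd k : `|k| < r -> forall v, `|d1 e (u + k) v - d1 e u v - d2 e u v k| <=
    eps / K * `|k| * `|v|.
  by move=> kr; apply: dr; rewrite -ball_normE/= sub0r normrN.
have rK : 0 < r / (`|v| + `|w| + 1) by rewrite divr_gt0// ltr_wpDl// addr_ge0.
near=> s.
have s0 : 0 < s by near: s; exact: nbhs_right_gt.
have sr : s * (`|v| + `|w| + 1) < r.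
  rewrite -ltr_pdivlMr; last by rewrite ltr_wpDl// addr_ge0.
  by near: s; exact: nbhs_right_lt.
have [c /andP[c0 cs] ->] := second_difference_MVT u v w s0.
have cvs : c * `|v| <= s * `|v| by rewrite ler_wpM2r// ltW.
set k1 := s *: w + c *: v; set k2 := c *: v.
have k1s : `|k1| <= s * (`|v| + `|w| + 1).
  rewrite (le_trans (ler_normD _ _))// !normrZ !gtr0_norm//.
  have := cvs; lra.
have k2s : `|k2| <= s * (`|v| + `|w| + 1).
  rewrite normrZ gtr0_norm//.
  have : 0 <= s * `|w| by rewrite mulr_ge0// ltW.
  have := cvs; lra.
have b1 := bnd k1 (le_lt_trans k1s sr) v.
have b2 := bnd k2 (le_lt_trans k2s sr) v.
have k12 : d2 e u v k1 = s * d2 e u v w + d2 e u v k2 by rewrite d2_linearr.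
rewrite -addrA -/k1.
rewrite k12 in b1; move: b1 b2.
(* From here on only the values of the derivatives matter. *)
move: (d1 e (u + k1) v) (d1 e (u + k2) v) (d1 e u v) (d2 e u v w) (d2 e u v k2).
move=> A B x y z b1 b2.
have -> : s * (A - B) - s ^+ 2 * y =
  s * ((A - x - (s * y + z)) - (B - x - z)) by ring.
rewrite normrM gtr0_norm//.
have -> : eps * s ^+ 2 = s * (eps / K * (s * K)) by field; rewrite gt_eqF.
rewrite ler_pM2l// (le_trans (ler_normB _ _))//.
rewrite (le_trans (lerD b1 b2))// -!mulrA -!mulrDr ler_pM2l//.
rewrite ler_pM2l ?invr_gt0// -mulrDl /K.
have k12s : `|k1| + `|k2| <= 2 * (s * (`|v| + `|w| + 1)).
  by rewrite mulr_natl mulr2n lerD.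
have v1 : `|v| <= `|v| + 1 by rewrite lerDl.
apply: le_trans (ler_pM _ _ k12s v1) _; rewrite ?addr_ge0//.
by rewrite le_eqVlt; apply/orP; left; apply/eqP; ring.
Unshelve. all: by end_near. Qed.

(** Both sides are the limit of the second difference divided by s^2, which is
symmetric in the two directions. *)
Lemma d2_sym u v w : d2 e u v w = d2 e u w v.
Proof.
apply/eqP; rewrite -subr_eq0 -normr_le0; apply/ler_addgt0Pl => eps eps0.
rewrite addr0; have eps2 : 0 < eps / 2 by rewrite divr_gt0.
have nvw := second_difference_d2 u v w eps2.
have nwv := second_difference_d2 u w v eps2.
have [s [[/= s0 vw] wv]] :=
  filter_ex (filterI (filterI (nbhs_right_gt (0 : R)) nvw) nwv).
have s2 : 0 < s ^+ 2 by rewrite exprn_gt0.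
rewrite (second_differenceC u w v) in wv; move: vw wv.
move: (d2 e u v w) (d2 e u w v) (second_difference u v w s) => a b x xa xb.
rewrite -(ler_pM2l s2) -[X in X * `|_|]gtr0_norm// -normrM.
have -> : s ^+ 2 * (a - b) = (x - s ^+ 2 * b) - (x - s ^+ 2 * a) by ring.
rewrite (le_trans (ler_normB _ _))// (le_trans (lerD xb xa))//.
by rewrite -mulrDl -splitr mulrC.
Qed.

End second_derivative.

(** * Differentiating the solution of a perturbed coercive equation *)

Lemma le0_of_small_multiples (R : realType) (x M r : R) : 0 < r ->
  (forall t, 0 < t < r -> x <= M * t) -> x <= 0.
Proof.
move=> r0 xM; have M1 : 0 < `|M| + 1 by rewrite ltr_wpDl.
rewrite leNgt; apply/negP => x0.
have xM0 : 0 < x / (`|M| + 1) by rewrite divr_gt0.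
pose t := Num.min r (x / (`|M| + 1)) / 2.
have m0 : 0 < Num.min r (x / (`|M| + 1)) by rewrite lt_min r0.
have t0 : 0 < t by rewrite divr_gt0.
have tm : t < Num.min r (x / (`|M| + 1)) by rewrite /t ltr_pdivrMr// ltr_pMr// ltrDl.
have := tm; rewrite lt_min => /andP[tr]; rewrite ltr_pdivlMr// => tx.
have := xM t; rewrite t0 tr => /(_ isT) xMt.
have : M * t <= `|M| * t by rewrite ler_wpM2r ?ler_norm// ltW.
nra.
Qed.

(** Sequences with a geometric rate suffice to sum up the difference quotients
below, and completeness of L^2 is proved directly for them. *)
Definition complete_for_fast_sequences {R : realType} (V : normedModType R) :=
  forall (x : nat -> V) (C : R),
  (forall i j, (i <= j)%N -> `|x i - x j| <= C * (2 ^+ i)^-1) -> cvgn x.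

(** The solutions g(t) of B(g(t),v) + t Q(g(t),v) = F(v) are studied for small t;
only the unperturbed form B has to be coercive. *)
Section perturbed_equation.
Context {R : realType} {V : normedModType R} (B Q : V -> V -> R).
Variables (c K rho : R) (g : R -> V) (F : V -> R).
Hypothesis V_complete : complete_for_fast_sequences V.
Hypotheses (c_gt0 : 0 < c) (K_gt0 : 0 < K) (rho_gt0 : 0 < rho).
Hypothesis B_linear : forall a x y z, B (a *: x + y) z = a * B x z + B y z.
Hypothesis Q_linear : forall a x y z, Q (a *: x + y) z = a * Q x z + Q y z.
Hypothesis B_coercive : forall v, c * `|v| ^+ 2 <= B v v.
Hypothesis B_bounded : forall v w, `|B v w| <= K * `|v| * `|w|.
Hypothesis Q_bounded : forall v w, `|Q v w| <= K * `|v| * `|w|.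
Hypothesis g_sol : forall t : R, `|t| < rho -> forall v,
  B (g t) v + t * Q (g t) v = F v.

(* For |t| < r the perturbation t Q takes up at most half of the coercivity of B. *)
Let r := Num.min rho (c / (2 * K)).
Let L := 4 * K * `|g 0| / c.
Let w t := t^-1 *: (g t - g 0).

Let r0 : 0 < r. Proof. by rewrite lt_min rho_gt0 divr_gt0// mulr_gt0. Qed.

Let L0 : 0 <= L. Proof. by rewrite divr_ge0 ?mulr_ge0// ltW. Qed.

Let BB x y z : B (x - y) z = B x z - B y z.
Proof. by rewrite addrC -scaleN1r B_linear mulN1r addrC. Qed.

Let QB x y z : Q (x - y) z = Q x z - Q y z.
Proof. by rewrite addrC -scaleN1r Q_linear mulN1r addrC. Qed.

(** Testing an equation with its own solution: the standard energy estimate. *)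
Let energy v (a : R) : 0 <= a -> B v v <= a * `|v| -> c * `|v| <= a.
Proof.
move=> a0 Ba; have [v0|v0] := eqVneq `|v| 0; first by rewrite v0 mulr0.
have vp : 0 < `|v| by rewrite lt_neqAle eq_sym v0 normr_ge0.
by rewrite -(ler_pM2r vp) -mulrA -expr2 (le_trans (B_coercive v)).
Qed.

Let sol_rho (t : R) : `|t| < r -> `|t| < rho.
Proof. by rewrite lt_min => /andP[]. Qed.

Let sol_c (t : R) : `|t| < r -> `|t| * K <= c / 2.
Proof.
rewrite lt_min ltr_pdivlMr ?mulr_gt0// => /andP[_ tc]; nra.
Qed.

(** The difference v of two solutions satisfies
B(v,v) = - t Q(v,v) - (t - s) Q(g(s),v), and the first term on the right is
absorbed by coercivity. *)
Let sol_diff (s t : R) : `|s| < r -> `|t| < r ->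
  c / 2 * `|g t - g s| <= K * `|t - s| * `|g s|.
Proof.
move=> sr tr; set v := g t - g s.
have Bv : B v v = - (t * Q v v) - (t - s) * Q (g s) v.
  have := g_sol (sol_rho tr) v; rewrite -(g_sol (sol_rho sr) v) => E.
  rewrite [in LHS]BB [in RHS]QB.
  by move: E; move: (B _ _) (B _ _) (Q _ _) (Q _ _) => *; lra.
have t1 : - (t * Q v v) <= `|t| * (K * `|v| * `|v|).
  rewrite (le_trans (ler_norm _))// normrN normrM ler_wpM2l//.
have t2 : - ((t - s) * Q (g s) v) <= `|t - s| * (K * `|g s| * `|v|).
  by rewrite (le_trans (ler_norm _))// normrN normrM ler_wpM2l.
have tc := sol_c tr.
suff : (c - `|t| * K) * `|v| <= K * `|t - s| * `|g s|.
  have : 0 <= `|v| by []. 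
  nra.
have a0 : 0 <= K * `|t - s| * `|g s| + `|t| * K * `|v|.
  by rewrite addr_ge0// !mulr_ge0// ltW.
rewrite mulrBl lerBlDr; apply: energy => //.
rewrite Bv (le_trans (lerD t1 t2))//.
by rewrite le_eqVlt; apply/orP; left; apply/eqP; ring.
Qed.

Let sol_lipschitz (s t : R) : `|s| < r -> `|t| < r -> `|g t - g s| <= L * `|t - s|.
Proof.
move=> sr tr.
have gs : `|g s| <= 2 * `|g 0|.
  have := @sol_diff 0 s; rewrite normr0 subr0 => /(_ r0 sr) h.
  have sc := sol_c sr.
  have h2 : c / 2 * `|g s - g 0| <= c / 2 * `|g 0|.
    by apply: le_trans h _; rewrite ler_wpM2r// mulrC.
  have h3 : `|g s - g 0| <= `|g 0| by rewrite -(ler_pM2l (divr_gt0 c_gt0 (ltr0n _ 2))).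
  rewrite -(subrK (g 0) (g s)) (le_trans (ler_normD _ _))//.
  by rewrite mulr_natl mulr2n lerD2r.
have c2 : 0 < c / 2 by rewrite divr_gt0.
rewrite -(ler_pM2l c2) (le_trans (sol_diff sr tr))//.
have -> : c / 2 * (L * `|t - s|) = K * `|t - s| * (2 * `|g 0|).
  by rewrite /L; field; rewrite gt_eqF.
by rewrite ler_wpM2l// mulr_ge0// ltW.
Qed.

Let B_quotient (t : R) v : `|t| < r -> t != 0 -> B (w t) v = - Q (g t) v.
Proof.
move=> tr t0; have := g_sol (sol_rho tr) v.
have := @g_sol 0; rewrite normr0 => /(_ rho_gt0 v) <-.
have -> : B (w t) v = t^-1 * (B (g t) v - B (g 0) v).
  have := B_linear t^-1 (g t - g 0) 0 v; rewrite addr0 => ->.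
  have := BB 0 0 v; rewrite subrr => ->.
  by rewrite BB subrr addr0.
rewrite mul0r addr0 => <-; field.
by [].
Qed.

(** The quotients solve B(w_t,v) = - Q(g(t),v), so they inherit the Lipschitz
estimate of the solutions themselves. *)
Let quotient_lipschitz (s t : R) : `|s| < r -> s != 0 -> `|t| < r -> t != 0 ->
  `|w t - w s| <= K * L / c * `|t - s|.
Proof.
move=> sr s0 tr t0.
rewrite -(ler_pM2l c_gt0) (_ : c * (_ * _) = K * (L * `|t - s|)); last first.
  by field; rewrite gt_eqF.
apply: energy; first exact: mulr_ge0 (ltW K_gt0) (mulr_ge0 L0 (normr_ge0 _)).
rewrite BB !B_quotient//.
rewrite opprK addrC -QB (le_trans (ler_norm _))//.
rewrite (le_trans (Q_bounded _ _))//.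
rewrite ler_wpM2r// ler_wpM2l ?(ltW K_gt0)//.
by rewrite distrC; exact: sol_lipschitz.
Qed.

(** The quotients along a geometric sequence of steps converge by completeness; the
Lipschitz estimate extends the convergence, with a rate, to all small steps, and
the equation for the quotients passes to the limit. *)
Lemma perturbed_equation_derivative : exists w0 C r, [/\ 0 < r,
  forall v, B w0 v = - Q (g 0) v &
  forall t : R, `|t| < r -> t != 0 -> `|t^-1 *: (g t - g 0) - w0| <= C * `|t|].
Proof.
set C := K * L / c; have C0 : 0 <= C.
  by apply: divr_ge0 (ltW c_gt0); exact: mulr_ge0 (ltW K_gt0) L0.
pose tau := geometric (r / 2) 2^-1.
have tau0 k : 0 < tau k by rewrite mulr_gt0 ?divr_gt0// exprn_gt0.
have tauS i j : (i <= j)%N -> tau j <= tau i.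
  move=> ij; rewrite ler_pM2l ?divr_gt0//.
  by rewrite ler_wiXn2l// invf_le1// ler1n.
have taur k : `|tau k| < r.
  rewrite gtr0_norm// (le_lt_trans (tauS _ _ (leq0n k)))//.
  by rewrite /tau/= expr0 mulr1 ltr_pdivrMr// ltr_pMr// ltrDl.
have taun0 k : tau k != 0 by rewrite gt_eqF.
have fast i j : (i <= j)%N ->
    `|w (tau i) - w (tau j)| <= C * (r / 2) * (2 ^+ i)^-1.
  move=> ij.
  rewrite (le_trans (quotient_lipschitz (taur j) (taun0 j) (taur i) (taun0 i)))//.
  rewrite -/C -[leRHS]mulrA ler_wpM2l//.
  have := tauS _ _ ij; have := tau0 j; rewrite /tau/= -exprVn => *.
  by rewrite ler_norml; apply/andP; split; lra.
have /cvg_ex[w0 w0E] := V_complete fast.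
have w0B t : `|t| < r -> t != 0 -> `|w t - w0| <= C * `|t|.
  move=> tr t0; have tau_cvg : tau @ \oo --> (0 : R).
    by apply: cvg_geometric; rewrite gtr0_norm// invf_lt1// ltr1n.
  have wn : `|w t - w (tau k)| @[k --> \oo] --> `|w t - w0|.
    by apply: cvg_norm; apply: cvgB => //; exact: cvg_cst.
  have tn : C * `|t - tau k| @[k --> \oo] --> C * `|t - 0|.
    apply: cvgM; first exact: cvg_cst.
    by apply: cvg_norm; apply: cvgB => //; exact: cvg_cst.
  rewrite subr0 in tn; apply: ler_cvg_to wn tn _.
  by apply: nearW => k; exact: quotient_lipschitz.
exists w0, C, r; split=> // v.
apply/eqP; rewrite -subr_eq0 opprK -normr_le0.
apply: (@le0_of_small_multiples _ _ (K * `|v| * (C + L)) r) => // t /andP[t0 tr].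
have tr' : `|t| < r by rewrite gtr0_norm.
have tn0 : t != 0 by rewrite gt_eqF.
have -> : B w0 v + Q (g 0) v = - B (w t - w0) v - Q (g t - g 0) v.
  by rewrite BB QB B_quotient//; ring.
have wt := w0B _ tr' tn0; have gt : `|g t - g 0| <= L * t.
  by have := @sol_lipschitz 0 t; rewrite normr0 subr0 (gtr0_norm t0); apply.
rewrite (le_trans (ler_normB _ _))// normrN.
rewrite (le_trans (lerD (B_bounded _ _) (Q_bounded _ _)))//.
rewrite (gtr0_norm t0) in wt.
have -> : K * `|v| * (C + L) * t = K * (C * t) * `|v| + K * (L * t) * `|v| by ring.
by apply: lerD; rewrite ler_wpM2r// ler_wpM2l// (ltW K_gt0).
Qed.

End perturbed_equation.

(** * Quadratic forms with bounded coefficients on L^2 functions and gradients *)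

(** Apply the hypothesis to the normalized vectors x/|x| and y/|y|. *)
Lemma bounded_of_quadratic (R : realType) (V : normedModType R) (B : V -> V -> R)
    (K : R) :
  (forall x y, B x y = B y x) ->
  (forall a x y z, B (a *: x + y) z = a * B x z + B y z) ->
  (forall x y, `|B x y| <= K / 2 * (`|x| ^+ 2 + `|y| ^+ 2)) ->
  forall x y, `|B x y| <= K * `|x| * `|y|.
Proof.
move=> BC Bl Bq x y.
have B0 z : B 0 z = 0.
  by have := Bl 1 0 0 z; rewrite scaler0 addr0 mul1r; lra.
have [->|x0] := eqVneq x 0; first by rewrite B0 !normr0 mulr0 mul0r.
have [->|y0] := eqVneq y 0; first by rewrite BC B0 !normr0 mulr0.
have BZ a v z : B (a *: v) z = a * B v z by rewrite -[a *: v]addr0 Bl B0 addr0.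
have nx : 0 < `|x| by rewrite normr_gt0.
have ny : 0 < `|y| by rewrite normr_gt0.
have normed (z : V) : z != 0 -> `| `|z|^-1 *: z| = 1.
  by move=> z0; rewrite normrZ normfV normr_id mulVf// normr_eq0.
have := Bq (`|x|^-1 *: x) (`|y|^-1 *: y).
rewrite !normed// BZ BC BZ BC !normrM !normfV !normr_id expr1n => h.
rewrite -mulrA mulrC -ler_pdivrMl ?mulr_gt0// invfM -mulrA.
by apply: le_trans h _; lra.
Qed.

Section coefficient_forms.
Context {R : realType} {n : nat} {Om : set 'rV[R]_n} (oOm : open Om).
Local Notation W := (L2_pair oOm).
Local Notation dx := (lebesgue_on oOm).
Local Notation V := (LfunType dx (lee1n 2) * {ffun 'I_n -> LfunType dx (lee1n 2)})%type.
Implicit Types (a : 'rV[R]_n -> R) (b : R) (x y z w : W).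

Lemma eq_Rintegral_ae (f h : 'rV[R]_n -> R) :
  dx.-integrable setT (EFin \o f) -> dx.-integrable setT (EFin \o h) ->
  (\forall t \ae dx, f t = h t) -> \int[dx]_t f t = \int[dx]_t h t.
Proof.
move=> /integrableP[mf _] /integrableP[mh _] fh.
congr fine; apply: ae_eq_integral => //.
by apply: filterS fh => t /= -> _.
Qed.

Definition bounded_coef a := measurable_fun setT a /\ exists K, forall t, `|a t| <= K.

Lemma integrable_coef a (f : 'rV[R]_n -> R) : bounded_coef a ->
  dx.-integrable setT (EFin \o f) ->
  dx.-integrable setT (EFin \o (fun t => a t * f t)).
Proof.
move=> [ma [K aK]] intf.
apply: (@integrableMr _ _ _ dx setT measurableT a (EFin \o f)) => //.
exists K; split; first exact: num_real.
by move=> M KM t _ /=; rewrite (le_trans (aK t))// ltW.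
Qed.

Lemma integrable_pair_ip (p q : V) : dx.-integrable setT
  (EFin \o (fun t => p.1 t * q.1 t)) /\
  dx.-integrable setT (EFin \o (fun t => \sum_i p.2 i t * q.2 i t)).
Proof.
split; first exact: integrable_L2_mul.
rewrite (_ : _ \o _ = fun t => (\sum_i (p.2 i t * q.2 i t)%:E)%E); last first.
  by apply/funext => t /=; rewrite sumEFin.
by apply: integrable_sum => // i _; exact: integrable_L2_mul.
Qed.

Definition coef_density a b x y t :=
  a t * (\sum_i (repr x).2 i t * (repr y).2 i t) + b * ((repr x).1 t * (repr y).1 t).

(** The weighted form of the problem, the form Q_l and the inner product of H^1 are
all instances, so their bilinearity, bounds and coercivity are proved once. *)
Definition coef_form a b x y := \int[dx]_t coef_density a b x y t.

Lemma integrable_coef_density a b x y : bounded_coef a ->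
  dx.-integrable setT (EFin \o coef_density a b x y).
Proof.
move=> ca; have [int1 int2] := integrable_pair_ip (repr x) (repr y).
apply: (@integrableD _ _ _ dx setT measurableT (EFin \o _) (EFin \o _)).
  exact: integrable_coef.
exact: (integrableZl measurableT b int1).
Qed.

Lemma coef_formC a b x y : coef_form a b x y = coef_form a b y x.
Proof.
apply: eq_Rintegral => t _; rewrite /coef_density [in RHS]mulrC.
rewrite [(repr y).1 t * _]mulrC [_ * a t]mulrC; congr (_ * _ + _).
by apply: eq_bigr => i _; rewrite mulrC.
Qed.

Lemma coef_form_linear a b k x y z : bounded_coef a ->
  coef_form a b (k *: x + y) z = k * coef_form a b x z + coef_form a b y z.
Proof.
move=> ca; have int := fun x y => integrable_coef_density b x y ca.
have intZ := integrableZl measurableT k (int x z).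
rewrite /coef_form -RintegralZl// -RintegralD//; apply: eq_Rintegral_ae => //.
  exact: (integrableD measurableT intZ (int y z)).
have /asboolP xy := repr_linear k x y.
apply: filterS xy => t [h1 h2].
rewrite /= /coef_density (_ : (repr (k *: x + y)).1 t =
  k * (repr x).1 t + (repr y).1 t)//.
have -> : \sum_i (repr (k *: x + y)).2 i t * (repr z).2 i t =
    k * (\sum_i (repr x).2 i t * (repr z).2 i t) +
    \sum_i (repr y).2 i t * (repr z).2 i t.
  rewrite mulr_sumr -big_split/=; apply: eq_bigr => i _.
  by rewrite h2 !ffunE -[LHS]/((k * (repr x).2 i t + (repr y).2 i t) * _); ring.
by ring.
Qed.

Lemma coef_form_coefD a a' b b' k x y : bounded_coef a -> bounded_coef a' ->
  coef_form (fun t => k * a t + a' t) (k * b + b') x y =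
  k * coef_form a b x y + coef_form a' b' x y.
Proof.
move=> ca ca'; have int := integrable_coef_density b x y ca.
have intZ := integrableZl measurableT k int.
have int' := integrable_coef_density b' x y ca'.
rewrite /coef_form -RintegralZl// -RintegralD//.
by apply: eq_Rintegral => t _; rewrite /coef_density; ring.
Qed.

Lemma coef_form_ge0 a b x : bounded_coef a -> 0 <= b ->
  (\forall t \ae dx, 0 <= a t) -> 0 <= coef_form a b x x.
Proof.
move=> ca b0 a0; have int := integrable_coef_density b x x ca.
have int' : dx.-integrable setT (EFin \o (fun t => `|coef_density a b x x t|)).
  exact: integrable_abse int.
rewrite /coef_form (eq_Rintegral_ae int int'); first exact: Rintegral_ge0.
apply: filterS a0 => t a0; rewrite ger0_norm// addr_ge0// mulr_ge0 ?sqr_ge0//.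
by apply: sumr_ge0 => i _; exact: sqr_ge0.
Qed.

Lemma L2_pair_ipE x y : L2_pair_ip x y = coef_form (cst 1) 1 x y.
Proof. by apply: eq_Rintegral => t _; rewrite /coef_density !mul1r addrC. Qed.

Lemma bounded_cst k : bounded_coef (cst k).
Proof. by split=> //; exists `|k|. Qed.

Lemma L2_pair_norm_sqr x : `|x| ^+ 2 = L2_pair_ip x x.
Proof. by rewrite sqr_sqrtr// L2_pair_ip_ge0. Qed.

(** Pointwise, |c u v| <= K (u^2 + v^2) / 2 when |c| <= K. *)
Lemma coef_form_bounded a b K : bounded_coef a -> `|b| <= K ->
  (forall t, `|a t| <= K) -> forall x y, `|coef_form a b x y| <= K * `|x| * `|y|.
Proof.
move=> ca bK aK; apply: bounded_of_quadratic.
- exact: coef_formC.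
- by move=> *; exact: coef_form_linear.
move=> x y; have K0 : 0 <= K by exact: le_trans bK.
have int := integrable_coef_density b x y ca.
have intx := integrable_coef_density 1 x x (bounded_cst 1).
have inty := integrable_coef_density 1 y y (bounded_cst 1).
have intxy := integrableD measurableT intx inty.
have intK := integrableZl measurableT (K / 2) intxy.
rewrite !L2_pair_norm_sqr !L2_pair_ipE /coef_form -RintegralD// -RintegralZl//.
  rewrite (le_trans (le_normr_Rintegral measurableT int))//.
  apply: le_Rintegral => //; first exact: integrable_abse int.
  move=> t _; rewrite /coef_density !mul1r.
  have half (c u v : R) : `|c| <= K -> `|c * (u * v)| <= K / 2 * (u * u + v * v).
    move=> cK; rewrite normrM (_ : K / 2 * _ = K * ((u * u + v * v) / 2)); last by ring.
    apply: ler_pM => //; rewrite ler_norml; apply/andP; split.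
      have := sqr_ge0 (u + v); nra.
    have := sqr_ge0 (u - v); nra.
  rewrite (le_trans (ler_normD _ _))//.
  rewrite [leRHS](_ : _ = K / 2 * (\sum_i (repr x).2 i t * (repr x).2 i t +
    \sum_i (repr y).2 i t * (repr y).2 i t) + K / 2 * ((repr x).1 t * (repr x).1 t +
    (repr y).1 t * (repr y).1 t)); last by ring.
  apply: lerD; last exact: half.
  rewrite mulr_sumr (le_trans (ler_norm_sum _ _ _))// -big_split/= mulr_sumr.
  by apply: ler_sum => i _; exact: half.
Qed.

Lemma L2_pair_ip_bounded x y : `|L2_pair_ip x y| <= `|x| * `|y|.
Proof.
rewrite L2_pair_ipE -[`|x|]mul1r; apply: coef_form_bounded => //.
- exact: bounded_cst.
- by rewrite normr1.
- by move=> t /=; rewrite normr1.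
Qed.

Lemma coef_form_coercive a b c : bounded_coef a -> c <= b ->
  (\forall t \ae dx, c <= a t) -> forall x, c * `|x| ^+ 2 <= coef_form a b x x.
Proof.
move=> ca cb cca x; have c1 := bounded_cst 1.
rewrite L2_pair_norm_sqr L2_pair_ipE -subr_ge0 addrC -mulNr.
rewrite -coef_form_coefD//; apply: coef_form_ge0; last 2 first.
- by rewrite mulr1 addrC subr_ge0.
- by apply: filterS cca => t; rewrite /= mulr1 addrC subr_ge0.
have [ma [K aK]] := ca; split.
  by apply: measurable_funD => //; exact: measurable_funM.
exists (`|c| + K) => t; rewrite /= mulr1 (le_trans (ler_normD _ _))// normrN.
by rewrite lerD2l.
Qed.

End coefficient_forms.

(** * Completeness of H^1_0 *)

Lemma cvg_of_dist0 (R : realType) (V : normedModType R) (v : nat -> V) (w : V) :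
  `|v k - w| @[k --> \oo] --> (0 : R) -> v @ \oo --> w.
Proof.
move=> /cvgr0Pnorm_lt vw; apply/cvgrPdistC_lt => eps eps0.
by apply: filterS (vw _ eps0) => k; rewrite normr_id.
Qed.

Section sobolev_complete.
Context {R : realType} {n : nat} {Om : set 'rV[R]_n} (oOm : open Om).
Local Notation W := (L2_pair oOm).
Local Notation dx := (lebesgue_on oOm).
Local Notation L2 := (LfunType dx (lee1n 2)).
Local Notation V := (L2 * {ffun 'I_n -> L2})%type.
Implicit Types (p q : V) (v w : W).

Lemma repr_pi p : pair_ae_eq (repr (\pi_(L2_pair oOm)%qT p : W)) p.
Proof. by apply/eqmodP; rewrite reprK. Qed.

Lemma L2_pair_ip_pi v p : L2_pair_ip v (\pi_(L2_pair oOm)%qT p : W) = pair_ip (repr v) p.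
Proof.
by rewrite /L2_pair_ip pair_ipC (pair_ip_ae_eq _ (repr_pi p)) pair_ipC.
Qed.

Lemma L2_pair_dist_sqr v w p : pair_ae_eq (repr w) p ->
  `|v - w| ^+ 2 = pair_ip (repr v - p) (repr v - p).
Proof.
move=> wp; have vwp : pair_ae_eq (repr (v - w)) (repr v - p).
  have /asboolP vw := repr_linear (-1) w v; have /asboolP wpt := wp.
  apply/asboolP; apply: filterS2 vw wpt => t [h1 h2] [p1 p2].
  rewrite (_ : v - w = -1 *: w + v); last by rewrite scaleN1r addrC.
  split=> [|i]; first by rewrite h1 -[LHS]/(-1 * (repr w).1 t + (repr v).1 t)
    -[RHS]/((repr v).1 t - p.1 t) p1 mulN1r addrC.
  rewrite h2 !ffunE -[LHS]/(-1 * (repr w).2 i t + (repr v).2 i t).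
  by rewrite -[RHS]/((repr v).2 i t - p.2 i t) p2 mulN1r addrC.
rewrite L2_pair_norm_sqr /L2_pair_ip (pair_ip_ae_eq _ vwp) pair_ipC.
by rewrite (pair_ip_ae_eq _ vwp).
Qed.

Lemma component_le_pair_ip p :
  (\int[dx]_t (p.1 t ^+ 2)%:E <= (pair_ip p p)%:E)%E /\
  forall i, (\int[dx]_t (p.2 i t ^+ 2)%:E <= (pair_ip p p)%:E)%E.
Proof.
have [int1 int2] := integrable_pair_ip p p.
have int := integrableD measurableT int1 int2.
have sum0 t : 0 <= \sum_i p.2 i t * p.2 i t.
  by apply: sumr_ge0 => i _; exact: sqr_ge0.
have ipE : ((pair_ip p p)%:E =
    \int[dx]_t (p.1 t * p.1 t + \sum_i p.2 i t * p.2 i t)%:E)%E.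
  by rewrite /pair_ip /Rintegral fineK//; exact: integrable_fin_num.
have mint : measurable_fun setT (fun t => (p.1 t * p.1 t + \sum_i p.2 i t * p.2 i t)%:E).
  by case/integrableP: int.
have mp (f : L2) : measurable_fun setT (fun t => (f t ^+ 2)%:E).
  apply/measurable_EFinP/measurable_funX.
  by have := sub_Lfun_mfun (LfunP f); rewrite inE.
split=> [|i]; rewrite ipE; apply: ge0_le_integral => //.
- by move=> t _; rewrite lee_fin sqr_ge0.
- by move=> t _; rewrite lee_fin expr2 lerDl.
- by move=> t _; rewrite lee_fin sqr_ge0.
- move=> t _; rewrite lee_fin expr2 ler_wpDl ?sqr_ge0// (bigD1 i)//=.
  by rewrite lerDl; apply: sumr_ge0 => j _; exact: sqr_ge0.
Qed.

Lemma pair_ip_le_components p (c : R) :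
  (\int[dx]_t (p.1 t ^+ 2)%:E <= c%:E)%E ->
  (forall i, \int[dx]_t (p.2 i t ^+ 2)%:E <= c%:E)%E ->
  pair_ip p p <= n.+1%:R * c.
Proof.
move=> p1 p2; have [int1 int2] := integrable_pair_ip p p.
have int := integrableD measurableT int1 int2.
have mp (f : L2) : measurable_fun setT (fun t => (f t ^+ 2)%:E).
  apply/measurable_EFinP/measurable_funX.
  by have := sub_Lfun_mfun (LfunP f); rewrite inE.
have p0 (f : L2) t : (0 <= (f t ^+ 2)%:E)%E by rewrite lee_fin sqr_ge0.
rewrite -lee_fin /pair_ip /Rintegral fineK; last exact: integrable_fin_num.
under eq_integral => t _.
  rewrite EFinD -sumEFin -expr2; under eq_bigr do rewrite -expr2.
  over.
rewrite ge0_integralD//=; first last.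
- by apply: emeasurable_sum => i; exact: mp.
- by move=> t _; apply: sume_ge0 => i _; exact: p0.
rewrite ge0_integral_sum//.
apply: (@le_trans _ _ (c%:E + \sum_(i < n) c%:E)%E).
  by apply: leeD => //; apply: lee_sum => i _.
rewrite sumEFin -EFinD lee_fin sumr_const card_ord.
by rewrite -natr1 mulrDl mul1r mulr_natl addrC.
Qed.

(** The pair (d_i phi, phi e_i): its inner product with (u, G) is the defect in the
integration by parts against phi in the i-th variable. *)
Definition weak_gradient_tester (phi : 'rV[R]_n -> R) (i : 'I_n)
  (tphi : test_function Om phi) : V :=
  (Lfun_Sub (lee1n 2) (test_function_Lfun2 oOm [:: i] tphi),
   [ffun j => if j == i then Lfun_Sub (lee1n 2) (test_function_Lfun2 oOm [::] tphi)
              else 0]).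

Lemma weak_gradient_tester_ip phi i (tphi : test_function Om phi) v :
  pair_ip (repr v) (weak_gradient_tester i tphi) =
  \int[dx]_t ((repr v).1 t * partial i phi t) +
  \int[dx]_t ((repr v).2 i t * phi t).
Proof.
rewrite -RintegralD//.
- apply: eq_Rintegral => t _; rewrite Lfun_valP; congr (_ + _).
  rewrite (bigD1 i)//= ffunE eqxx Lfun_valP big1 ?addr0// => j /negbTE ji.
  by rewrite ffunE ji mulr0.
- exact: (integrable_L2_test (repr v).1 [:: i] tphi).
- exact: (integrable_L2_test ((repr v).2 i) [::] tphi).
Qed.

(** Being a weak gradient means being orthogonal to all the pairs
[weak_gradient_tester], a closed condition. *)
Lemma H1_closed (v : nat -> W) w : (forall k, H1 (v k)) ->
  `|v k - w| @[k --> \oo] --> (0 : R) -> H1 w.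
Proof.
move=> v1 vw phi i tphi; apply/eqP; rewrite -addr_eq0 -weak_gradient_tester_ip.
rewrite -L2_pair_ip_pi -normr_le0; set psi := (\pi_(L2_pair oOm)%qT _ : W).
have bnd k : `|L2_pair_ip w psi| <= `|v k - w| * `|psi|.
  have vk : L2_pair_ip (v k) psi = 0.
    rewrite L2_pair_ip_pi weak_gradient_tester_ip; apply/eqP.
    by rewrite addr_eq0; apply/eqP; exact: v1.
  have -> : L2_pair_ip w psi = - L2_pair_ip (v k - w) psi.
    rewrite addrC L2_pair_ipDl vk addr0 -[- w]scaleN1r L2_pair_ipZl.
    by rewrite mulN1r opprK.
  by rewrite normrN; exact: L2_pair_ip_bounded.
have lim0 : `|v k - w| * `|psi| @[k --> \oo] --> 0 * `|psi|.
  by apply: cvgM => //; exact: cvg_cst.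
rewrite mul0r in lim0.
have limc : `|L2_pair_ip w psi| @[k --> \oo] --> `|L2_pair_ip w psi| by exact: cvg_cst.
by apply: ler_cvg_to limc lim0 _; exact: nearW.
Qed.

Lemma pair_sub2E p q i t : (p - q).2 i t = p.2 i t - q.2 i t.
Proof. by rewrite -[LHS]/((p.2 - q.2) i t) !ffunE. Qed.

(** Each component of the sequence is fast Cauchy in L^2, since its distances are
bounded by those of the pairs. *)
Lemma L2_pair_complete (v : nat -> W) (C : R) :
  (forall i j, (i <= j)%N -> `|v i - v j| <= C * (2 ^+ i)^-1) ->
  exists w, `|v k - w| @[k --> \oo] --> (0 : R).
Proof.
move=> vC; have C0 : 0 <= C.
  by have := vC 0%N 0%N (leqnn _); rewrite expr0 invr1 mulr1; exact: le_trans.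
have cauchy i j : (i <= j)%N -> pair_ip (repr (v i) - repr (v j))
    (repr (v i) - repr (v j)) <= C ^+ 2 * (4 ^+ i)^-1.
  have jj : pair_ae_eq (repr (v j)) (repr (v j)) by apply/asboolP; exact: aeW.
  move=> ij; rewrite -(L2_pair_dist_sqr _ jj).
  rewrite (_ : 4 = 2 ^+ 2); last by rewrite expr2; ring.
  rewrite -exprM mulnC exprM -exprVn -exprMn ler_pXn2r ?nnegrE//.
    exact: vC.
  by rewrite mulr_ge0// invr_ge0 exprn_ge0.
have [F0 F0L F0E] : exists2 F, F \in Lfun dx 2%:E & forall i,
    (\int[dx]_t (((repr (v i)).1 t - F t) ^+ 2)%:E <= (C ^+ 2 * (4 ^+ i)^-1)%:E)%E.
  apply: L2_complete => [k|i j ij]; first exact: LfunP.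
  apply: le_trans (component_le_pair_ip (repr (v i) - repr (v j))).1 _.
  by rewrite lee_fin; exact: cauchy.
have /choice[F FE] (k : 'I_n) : exists F : L2, forall i,
    (\int[dx]_t (((repr (v i)).2 k t - F t) ^+ 2)%:E <= (C ^+ 2 * (4 ^+ i)^-1)%:E)%E.
  have [F FL FE] : exists2 F, F \in Lfun dx 2%:E & forall i,
      (\int[dx]_t (((repr (v i)).2 k t - F t) ^+ 2)%:E <= (C ^+ 2 * (4 ^+ i)^-1)%:E)%E.
    apply: L2_complete => [i|i j ij]; first exact: LfunP.
    rewrite (eq_integral (fun t => ((repr (v i) - repr (v j)).2 k t ^+ 2)%:E)).
      apply: le_trans ((component_le_pair_ip _).2 k) _.
      by rewrite lee_fin; exact: cauchy.
    by move=> t _; rewrite pair_sub2E.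
  by exists (Lfun_Sub (lee1n 2) FL) => i; rewrite Lfun_valP.
pose p : V := (Lfun_Sub (lee1n 2) F0L, [ffun k => F k]).
exists (\pi_(L2_pair oOm)%qT p : W).
have dist i : `|v i - \pi_(L2_pair oOm)%qT p| <=
    Num.sqrt n.+1%:R * C * (2 ^+ i)^-1.
  have C2 : 0 <= C * (2 ^+ i)^-1 by rewrite mulr_ge0// invr_ge0 exprn_ge0.
  rewrite -mulrA -(ler_pXn2r (ltn0Sn 1)) ?nnegrE ?mulr_ge0 ?sqrtr_ge0//.
  rewrite (L2_pair_dist_sqr _ (repr_pi p)) !exprMn sqr_sqrtr// exprVn -exprM mulnC.
  rewrite exprM (_ : 2 ^+ 2 = 4); last by rewrite expr2; ring.
  apply: pair_ip_le_components => [|k].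
    by rewrite (eq_integral (fun t => (((repr (v i)).1 t - F0 t) ^+ 2)%:E)).
  rewrite (eq_integral (fun t => (((repr (v i)).2 k t - F k t) ^+ 2)%:E))//.
  by move=> t _; rewrite pair_sub2E ffunE.
apply: (squeeze_cvgr (f := cst 0)
  (h := geometric (Num.sqrt n.+1%:R * C) 2^-1)).
- by apply: nearW => k; rewrite normr_ge0/= exprVn dist.
- exact: cvg_cst.
- by apply: cvg_geometric; rewrite gtr0_norm// invf_lt1// ltr1n.
Qed.

(** H^1_0 is closed in the complete space of pairs: it is the intersection of the
closed set [H1] with a closure. *)
Lemma H10_complete : complete_for_fast_sequences (H10 oOm).
Proof.
move=> x C xC; have [w xw] := L2_pair_complete (v := H10_val (oOm:=oOm) \o x) xC.
have w10 : w \in @H10_pred R n Om oOm.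
  have mem k : H1 (H10_val (x k)) /\ closure (H1_test (oOm := oOm)) (H10_val (x k)).
    by have := valP (x k); rewrite inE.
  rewrite inE; split.
    by apply: H1_closed xw => k; have [] := mem k.
  apply: (closed_cvg (u_ := H10_val (oOm:=oOm) \o x) (F := \oo)); last exact: cvg_of_dist0.
  - exact: closed_closure.
  - by apply: nearW => k; have [] := mem k.
apply/cvg_ex; exists (Build_H10 w10); exact: cvg_of_dist0.
Qed.


End sobolev_complete.

(** * Forms with coefficients constant on the pieces *)

Lemma exists_pos_lower_bound (R : realType) (I : finType) (f : I -> R) :
  (forall i, 0 < f i) -> exists c, [/\ 0 < c, c <= 1 & forall i, c <= f i].
Proof.
move=> f0; exists (\big[Num.min/1]_i f i); split.
- by apply: lt_bigmin.
- exact: bigmin_le_id.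
- by move=> i; exact: bigmin_le.
Qed.

Section step_forms.
Context {R : realType} {n N : nat} {Om : set 'rV[R]_n} {oOm : open Om}.
Local Notation H := (H10 oOm).
Local Notation dx := (lebesgue_on oOm).
Variable Omi : 'I_N -> set 'rV[R]_n.
Hypothesis Omi_partition : lipschitz_partition Om Omi.
Implicit Types (l : 'rV[R]_N) (b : R) (v w : H).

Lemma step_fun_in l i t : Omi i t -> step_fun Omi l t = l ord0 i.
Proof.
have [_ tO _ _] := Omi_partition; move=> it.
rewrite /step_fun (bigD1 i)//= indicE mem_set// mulr1 big1 ?addr0// => j ji.
rewrite indicE memNset ?mulr0// => jt; case/eqP: ji.
by apply: (tO j i) => //; exists t.
Qed.

Lemma step_fun_linear k l l' :
  step_fun Omi (k *: l + l') = fun t => k * step_fun Omi l t + step_fun Omi l' t.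
Proof.
apply/funext => t; rewrite /step_fun mulr_sumr -big_split/=.
by apply: eq_bigr => i _; rewrite !mxE mulrDl mulrA.
Qed.

Lemma step_fun_le l t : `|step_fun Omi l t| <= \sum_i `|l ord0 i|.
Proof.
apply: le_trans (ler_norm_sum _ _ _) _; apply: ler_sum => i _.
by rewrite normrM indicE; case: (_ \in _); rewrite ?normr1 ?mulr1// normr0 mulr0.
Qed.

Lemma bounded_step_fun l : bounded_coef (step_fun Omi l).
Proof.
have [oO _ _ _] := Omi_partition.
split; last by exists (\sum_i `|l ord0 i|) => t; exact: step_fun_le.
apply: measurable_sum => i; apply: measurable_funM => //.
by apply: measurable_indic; apply: open_measurable_rV; have [] := oO i.
Qed.

(** [step_fun] vanishes outside the pieces, but they cover [Om] up to a null set. *)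
Lemma step_fun_ge_ae l (c : R) : (forall i, c <= l ord0 i) ->
  \forall t \ae dx, c <= step_fun Omi l t.
Proof.
have [oO _ _ O0] := Omi_partition => cl.
exists (~` \bigcup_i Omi i); split.
- apply: measurableC; apply: open_measurable_rV; apply: bigcup_open => i _.
  by have [] := oO i.
- by rewrite [LHS](_ : _ = lebesgue_rV n (Om `\` \bigcup_i Omi i)) // /lebesgue_on /mrestr setIC.
- by move=> t /= ct [i _ it]; apply: ct; rewrite (step_fun_in _ it).
Qed.

Definition step_form l b v w := coef_form (step_fun Omi l) b (H10_val v) (H10_val w).

Lemma weighted_formE l v w : weighted_form Omi l v w = step_form l 1 v w.
Proof. by apply: eq_Rintegral => t _; rewrite /coef_density mul1r. Qed.

Lemma step_form_linear l b k v w z :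
  step_form l b (k *: v + w) z = k * step_form l b v z + step_form l b w z.
Proof. by rewrite /step_form -coef_form_linear//; exact: bounded_step_fun. Qed.

Lemma step_form_coefD k l l' b b' v w : step_form (k *: l + l') (k * b + b') v w =
  k * step_form l b v w + step_form l' b' v w.
Proof.
by rewrite /step_form step_fun_linear coef_form_coefD//; exact: bounded_step_fun.
Qed.

Lemma step_form_bounded l b v w :
  `|step_form l b v w| <= (\sum_i `|l ord0 i| + `|b|) * `|v| * `|w|.
Proof.
apply: coef_form_bounded; first exact: bounded_step_fun.
- by rewrite lerDr; apply: sumr_ge0.
- by move=> t; rewrite (le_trans (step_fun_le _ _))// lerDl.
Qed.

Lemma step_form_coercive l b (c : R) v : c <= b -> (forall i, c <= l ord0 i) ->
  c * `|v| ^+ 2 <= step_form l b v v.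
Proof.
move=> cb cl; apply: coef_form_coercive => //; first exact: bounded_step_fun.
exact: step_fun_ge_ae.
Qed.

(** The partial derivatives of a test function vanish outside its support, which
lies in the i-th piece, where the coefficient is constant. *)
Lemma step_form_local l b i phi v w : test_function (Omi i) phi ->
  represents (H10_val w) phi ->
  step_form l b v w = coef_form (cst (l ord0 i)) b (H10_val v) (H10_val w).
Proof.
move=> [_ _ phiO] wphi; apply: eq_Rintegral_ae.
- exact: integrable_coef_density (bounded_step_fun l).
- exact: integrable_coef_density (bounded_cst _).
apply: filterS wphi => t [_ wt]; rewrite /coef_density/=; congr (_ + _).
have [it|nit] := pselect (Omi i t); first by rewrite (step_fun_in _ it).
rewrite big1 ?mulr0// => j _; rewrite wt.
have [->|d0] := eqVneq (partial j phi t) 0; first by rewrite mulr0.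
by case: nit; apply/phiO/supp_partial/d0.
Qed.

Lemma coef_form0_test i phi v w : test_function (Omi i) phi ->
  represents (H10_val w) phi ->
  coef_form (cst 0) 1 (H10_val v) (H10_val w) = \int[dx]_t (fn v t * phi t).
Proof.
move=> [sphi cphi phiO] wphi; apply: eq_Rintegral_ae.
- exact: integrable_coef_density (bounded_cst _).
- apply: (integrable_L2_test (repr (H10_val v)).1 [::]); split=> //.
  have [_ _ OO _] := Omi_partition; exact: subset_trans phiO (OO i).
by apply: filterS wphi => t [wt _]; rewrite /coef_density /= mul0r add0r mul1r wt.
Qed.

End step_forms.

(** * Derivative of the solution with respect to the coefficients *)

Section sensitivity.
Context {R : realType} {n N : nat} {Om : set 'rV[R]_n} {oOm : open Om}.
Local Notation H := (H10 oOm).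
Context (Omi : 'I_N -> set 'rV[R]_n) (F : H -> R) (g : 'rV[R]_N -> H).
Context (lhat : 'rV[R]_N).
Hypothesis Omi_partition : lipschitz_partition Om Omi.
Hypothesis lhat_pos : Lambda_pos lhat.
Hypothesis g_sol : forall lam, Lambda_pos lam ->
  forall v, weighted_form Omi lam (g lam) v = F v.

Lemma Lambda_pos_near l : exists rho : R, 0 < rho /\
  forall t : R, `|t| < rho -> Lambda_pos (t *: l + lhat).
Proof.
have [i|rho [rho0 _ rhol]] :=
    @exists_pos_lower_bound _ 'I_N (fun i => lhat ord0 i / (`|l ord0 i| + 1)).
  by rewrite divr_gt0// ltr_wpDl.
exists rho; split=> // t trho i; rewrite !mxE.
have l1 : 0 < `|l ord0 i| + 1 by rewrite ltr_wpDl.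
have := rhol i; rewrite ler_pdivlMr// => rl.
have tl : `|t * l ord0 i| <= `|t| * (`|l ord0 i| + 1).
  by rewrite normrM ler_wpM2l// lerDl.
have tr : `|t| * (`|l ord0 i| + 1) < rho * (`|l ord0 i| + 1) by rewrite ltr_pM2r.
have : - (t * l ord0 i) <= `|t * l ord0 i| by rewrite -normrN ler_norm.
lra.
Qed.

Lemma step_form_lhat_coercive : exists2 c, 0 < c &
  forall v : H, c * `|v| ^+ 2 <= step_form Omi lhat 1 v v.
Proof.
have [c [c0 c1 cl]] := exists_pos_lower_bound lhat_pos.
by exists c => // v; exact: step_form_coercive.
Qed.

Lemma step_form_lhat_inj (v w : H) :
  (forall z, step_form Omi lhat 1 v z = step_form Omi lhat 1 w z) -> v = w.
Proof.
have [c c0 cB] := step_form_lhat_coercive => vw.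
apply/eqP; rewrite -subr_eq0 -normr_eq0 -sqrf_eq0 eq_le sqr_ge0 andbT.
rewrite -(ler_pM2l c0) mulr0 (le_trans (cB _))//.
rewrite (_ : v - w = -1 *: w + v); last by rewrite scaleN1r addrC.
by rewrite step_form_linear// vw mulN1r addNr.
Qed.

(** [perturbed_equation_derivative] for the weighted form and Q_l; the last clause
makes ['D_l g lhat] a genuine derivative, with a rate. *)
Lemma solution_derivative l : exists C r : R, [/\ 0 < r,
  (forall v : H, step_form Omi lhat 1 ('D_l g lhat) v = - step_form Omi l 0 (g lhat) v) &
  (forall t : R, `|t| < r -> t != 0 ->
    `|t^-1 *: (g (t *: l + lhat) - g lhat) - 'D_l g lhat| <= C * `|t|)].
Proof.
have [c c0 cB] := step_form_lhat_coercive.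
have [rho [rho0 rhoL]] := Lambda_pos_near l.
pose K : R := \sum_i `|lhat ord0 i| + 1 + (\sum_i `|l ord0 i| + 1).
have sum0 (k : 'rV[R]_N) : 0 <= \sum_i `|k ord0 i| by apply: sumr_ge0.
have K0 : 0 < K by rewrite addr_gt0// ltr_wpDl.
have BK (v w : H) : `|step_form Omi lhat 1 v w| <= K * `|v| * `|w|.
  apply: (le_trans (step_form_bounded Omi_partition lhat 1 v w)).
  rewrite -!mulrA ler_wpM2r ?mulr_ge0// normr1 lerDl addr_ge0//.
have QK (v w : H) : `|step_form Omi l 0 v w| <= K * `|v| * `|w|.
  apply: (le_trans (step_form_bounded Omi_partition l 0 v w)).
  rewrite -!mulrA ler_wpM2r ?mulr_ge0// normr0 addr0 /K.
  have := sum0 lhat; lra.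
have sol (t : R) : `|t| < rho -> forall v : H,
    step_form Omi lhat 1 (g (t *: l + lhat)) v +
    t * step_form Omi l 0 (g (t *: l + lhat)) v = F v.
  move=> /rhoL tl v; rewrite -(g_sol tl) weighted_formE.
  by rewrite addrC -step_form_coefD// mulr0 add0r.
have [w [C [r [r0 wB wC]]]] := perturbed_equation_derivative
  (g := fun t => g (t *: l + lhat)) (@H10_complete _ _ _ oOm) c0 K0 rho0
  (step_form_linear Omi_partition lhat 1) (step_form_linear Omi_partition l 0)
  cB BK QK sol.
rewrite scale0r add0r in wB wC.
suff -> : 'D_l g lhat = w by exists C, r.
rewrite /derive; apply/cvg_lim; first exact: norm_hausdorff.
apply/cvgrPdistC_le => eps eps0.
have C1 : 0 < `|C| + 1 by rewrite ltr_wpDl.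
near=> t.
have tn0 : t != 0 by near: t; exact: nbhs_dnbhs_neq.
have tr : `|t| < r by near: t; exact: dnbhs0_lt.
have te : `|t| < eps / (`|C| + 1) by near: t; apply: dnbhs0_lt; rewrite divr_gt0.
rewrite /= (le_trans (wC _ tr tn0))//.
move: te; rewrite ltr_pdivlMr// => te.
have : C * `|t| <= `|C| * `|t| by rewrite ler_wpM2r// ler_norm.
have : 0 <= `|t| by [].
lra.
Unshelve. all: by end_near. Qed.

Lemma solution_derivative_linear (k : R) l l' :
  'D_(k *: l + l') g lhat = k *: 'D_l g lhat + 'D_l' g lhat.
Proof.
apply: step_form_lhat_inj => z; rewrite step_form_linear//.
have [? [? [_ -> _]]] := solution_derivative l.
have [? [? [_ -> _]]] := solution_derivative l'.
have [? [? [_ -> _]]] := solution_derivative (k *: l + l').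
rewrite -[X in step_form _ _ X](mulr0 k) -[k * 0]addr0 step_form_coefD//.
by rewrite opprD mulrN.
Qed.

Lemma solution_derivative0 : 'D_0 g lhat = 0.
Proof.
have := solution_derivative_linear 1 0 0.
rewrite scaler0 addr0 scale1r => /eqP.
by rewrite -[X in X == _]addr0 (inj_eq (addrI _)) eq_sym => /eqP.
Qed.

Lemma solution_derivative_basis l :
  'D_l g lhat = \sum_i l ord0 i *: 'D_(delta_mx ord0 i) g lhat.
Proof.
rewrite {1}[l]row_sum_delta.
elim/big_rec2 : _ => [|i y x _ <-]; first exact: solution_derivative0.
exact: solution_derivative_linear.
Qed.

Lemma tangent_spaceE : tangent_space g lhat =
  Defs.span (range (fun i => 'D_(delta_mx ord0 i) g lhat)).
Proof.
apply/seteqP; split.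
  apply: sub_span_range => _ [l _ <-]; apply/span_rangeP.
  by exists (fun i => l ord0 i); rewrite -solution_derivative_basis.
by apply: sub_span => _ [i _ <-]; exists (delta_mx ord0 i).
Qed.

Lemma tangent_spaceB v w : tangent_space g lhat v -> tangent_space g lhat w ->
  tangent_space g lhat (v - w).
Proof.
rewrite tangent_spaceE => /span_rangeP[a ->] /span_rangeP[b ->].
apply/span_rangeP; exists (fun i => a i - b i).
by rewrite -sumrB; apply: eq_bigr => i _; rewrite scalerBl.
Qed.

(** When ['D_l g lhat] vanishes, its equation tested in the i-th piece reads
l_i int grad g . grad v = 0.  So the gradient term drops out of the equation
solved by [g], which leaves int g phi = F(v). *)
Lemma derivative_vanishes_local l i phi (v : H) :
  'D_l g lhat = 0 -> l ord0 i != 0 ->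
  test_function (Omi i) phi -> represents (H10_val v) phi ->
  \int[lebesgue_on oOm]_x (fn (g lhat) x * phi x) = F v.
Proof.
move=> Dl0 li tphi vphi.
have [? [? [_ /(_ v) DB _]]] := solution_derivative l.
have Q0 : step_form Omi l 0 (g lhat) v = 0.
  apply/eqP; rewrite -oppr_eq0 -DB Dl0.
  have := step_form_linear Omi_partition lhat 1 1 0 0 v.
  by rewrite scaler0 addr0 mul1r => /eqP; rewrite -subr_eq subrr eq_sym.
(* The form with constant coefficients a on gradients and b on values, at (g, v). *)
pose G a b := coef_form (cst a) b (H10_val (g lhat)) (H10_val v).
have GD k a a' b b' : G (k * a + a') (k * b + b') = k * G a b + G a' b'.
  by rewrite /G -coef_form_coefD//; exact: bounded_cst.
have G00 : G 0 0 = 0.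
  by have := GD 1 0 0 0 0; rewrite mulr0 addr0; lra.
have GE a b : G a b = a * G 1 0 + G 0 b.
  by rewrite -GD mulr1 addr0 mulr0 add0r.
rewrite -(g_sol lhat_pos) weighted_formE.
rewrite (step_form_local Omi_partition _ _ _ tphi vphi) -/(G _ _) GE.
have G10 : G 1 0 = 0.
  have : G (l ord0 i) 0 = 0 by rewrite /G -(step_form_local Omi_partition _ _ _ tphi vphi).
  rewrite GE G00.
  by rewrite addr0 => /eqP; rewrite mulf_eq0 (negbTE li) => /eqP.
by rewrite G10 mulr0 add0r -(coef_form0_test Omi_partition _ tphi vphi).
Qed.

End sensitivity.

(** * Optimality and the projection of the Newton step *)

Section optimality.
Context {R : realType} {V : normedModType R} (e : V -> R) (M kappa : R) (u h : V).
Hypothesis e_C2 : C2 e.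
Hypotheses (M_ge0 : 0 <= M) (kappa_gt0 : 0 < kappa).
Hypothesis e_bounded : forall v w, `|d2 e u v w| <= M * `|v| * `|w|.
Hypothesis h_newton : forall v, d2 e u h v = d1 e u v.

Let q v := kappa / 2 * d2 e u v v - d1 e u v.

(** The Newton step [h] represents [d1 e u] in the form [d2 e u], so the slope of
the model at [v] is the pairing with kappa v - h. *)
Lemma quadratic_model_expansion (t : R) v w :
  q (t *: w + v) - q v =
  t * (d2 e u (kappa *: v - h) w + t * (kappa / 2 * d2 e u w w)).
Proof.
have -> : d2 e u (kappa *: v - h) w = kappa * d2 e u v w - d1 e u w.
  rewrite addrC -scaleN1r d2_linearl// -[kappa *: v]addr0 d2_linearl//.
  have : d2 e u 0 w = 0.
    by have := d2_linearl e_C2 u 1 0 0 w; rewrite scaler0 addr0; lra.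
  by move=> ->; rewrite h_newton; ring.
rewrite /q d1_linear// d2_linearl// !d2_linearr// (d2_sym e_C2 u w v).
move: (d2 e u w w) (d2 e u v w) (d2 e u v v) (d1 e u w) (d1 e u v) => *.
by field.
Qed.

(** In terms of the difference quotients w_t the model increases by
t (e''(kappa v - h, w_t) + O(t)), and w_t tends to [w]. *)
Lemma optimality_along_curve (gam : R -> V) v w (C r : R) : 0 < r ->
  (forall t : R, `|t| < r -> t != 0 -> `|t^-1 *: (gam t - v) - w| <= C * `|t|) ->
  (forall t : R, `|t| < r -> q v <= q (gam t)) ->
  0 <= d2 e u (kappa *: v - h) w.
Proof.
move=> r0 gamC gam_min; rewrite -oppr_le0.
set z := kappa *: v - h.
pose B := M * `|z| * C + kappa / 2 * M * (`|w| + C * r) ^+ 2.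
apply: (@le0_of_small_multiples _ _ B r) => // t /andP[t0 tr].
have tr' : `|t| < r by rewrite gtr0_norm.
have tn0 : t != 0 by rewrite gt_eqF.
set wt := t^-1 *: (gam t - v).
have gamE : gam t = t *: wt + v by rewrite scalerA mulfV// scale1r subrK.
have wtC : `|wt - w| <= C * t by have := gamC _ tr' tn0; rewrite (gtr0_norm t0).
have C0 : 0 <= C by rewrite -(pmulr_lge0 _ t0) (le_trans _ wtC).
have wtn : `|wt| <= `|w| + C * r.
  rewrite -(subrK w wt) addrC (le_trans (ler_normD _ _))// lerD2l.
  by rewrite (le_trans wtC)// ler_wpM2l// ltW.
have : 0 <= q (gam t) - q v by rewrite subr_ge0; exact: gam_min.
rewrite gamE quadratic_model_expansion pmulr_rge0// -/z => opt.
have zw : d2 e u z wt = d2 e u z (wt - w) + d2 e u z w.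
  by rewrite -{1}(subrK w wt) -[wt - w]scale1r d2_linearr// mul1r scale1r.
have b1 : d2 e u z (wt - w) <= M * `|z| * (C * t).
  apply: le_trans (ler_norm _) _; apply: le_trans (e_bounded _ _) _.
  by rewrite ler_wpM2l// mulr_ge0.
have b2 : kappa / 2 * d2 e u wt wt <= kappa / 2 * M * (`|w| + C * r) ^+ 2.
  rewrite -[leRHS]mulrA ler_pM2l ?divr_gt0//.
  apply: le_trans (ler_norm _) _; apply: le_trans (e_bounded _ _) _.
  rewrite -mulrA ler_wpM2l// -expr2 ler_pXn2r// nnegrE//.
  by rewrite addr_ge0// mulr_ge0// ltW.
have b3 := ler_wpM2l (ltW t0) b2.
have -> : B * t = M * `|z| * (C * t) +
    t * (kappa / 2 * M * (`|w| + C * r) ^+ 2) by rewrite /B; ring.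
apply: le_trans (lerD b1 b3).
by rewrite -subr_ge0 opprK addrAC -zw.
Qed.

End optimality.

Theorem corollary3p2 (R : realType) (n : nat) (n_gt0 : (0 < n)%N)
  (Om : set 'rV[R]_n) (oOm : open Om)
  (Om_neq0 : Om !=set0) (Om_connected : connected Om)
  (Om_lipschitz : lipschitz_boundary Om)
  (e : H10 oOm -> R) (M m kappa : R)
  (M_gt0 : 0 < M) (m_gt0 : 0 < m) (kappa_gt0 : 0 < kappa)
  (e_C2 : C2 e)
  (e_bounded : forall u v w : H10 oOm, `|d2 e u v w| <= M * `|v| * `|w|)
  (e_coercive : forall u v : H10 oOm, m * `|v| ^+ 2 <= d2 e u v v)
  (N : nat) (Omi : 'I_N -> set 'rV[R]_n)
  (Omi_partition : lipschitz_partition Om Omi)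
  (u : H10 oOm) (g : 'rV[R]_N -> H10 oOm)
  (g_sol : forall lam, Lambda_pos lam ->
    forall v, weighted_form Omi lam (g lam) v = d1 e u v)
  (lhat : 'rV[R]_N) (lhat_pos : Lambda_pos lhat)
  (lhat_min : forall lam, Lambda_pos lam ->
    model kappa e u (g lhat) <= model kappa e u (g lam))
  (P : H10 oOm -> H10 oOm)
  (P_range : forall w, tangent_space g lhat (P w))
  (P_orthogonal : forall w v, tangent_space g lhat v ->
    d2 e u (w - P w) v = 0)
  (h : H10 oOm) (h_newton : forall v, d2 e u h v = d1 e u v) :
  P h = P (kappa *: g lhat) /\
  exists k : nat,
    [/\ has_dim (tangent_space g lhat) k,
        (#|[set i : 'I_N | `[< ~ eq_g0_on e u (g lhat) (Omi i) >]]%SET| <= k)%N &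
        (k <= N)%N].
Proof.
pose D l := 'D_l g lhat; pose z := kappa *: g lhat - h.
have DL k l l' : D (k *: l + l') = k *: D l + D l'.
  exact: (solution_derivative_linear Omi_partition lhat_pos g_sol).
have D0 : D 0 = 0 := solution_derivative0 Omi_partition lhat_pos g_sol.
have opt_ge0 l : 0 <= d2 e u z (D l).
  have [C [r [r0 _ DC]]] := solution_derivative Omi_partition lhat_pos g_sol l.
  (* [lhat_min] only speaks of positive steps, hence the restriction to |t| < rho. *)
  have [rho [rho0 rhoL]] := Lambda_pos_near lhat_pos l.
  apply: (optimality_along_curve e_C2 (ltW M_gt0) kappa_gt0 (e_bounded u)
    h_newton (gam := fun t => g (t *: l + lhat)) (r := Num.min r rho) (C := C)).
  - by rewrite lt_min r0.
  - by move=> t; rewrite lt_min => /andP[tr _]; exact: DC.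
  - by move=> t; rewrite lt_min => /andP[_ trho]; apply: lhat_min; exact: rhoL.
have opt0 l : d2 e u z (D l) = 0.
  apply/eqP; rewrite eq_le opt_ge0 andbT.
  have := opt_ge0 (- l).
  rewrite -[- l]addr0 -scaleN1r DL D0 d2_linearr//.
  have := d2_linearr e_C2 u z 1 0 0; rewrite scaler0 addr0 mul1r.
  move: (d2 e u z 0) (d2 e u z (D l)) => x y; lra.
have TE := tangent_spaceE Omi_partition lhat_pos g_sol.
have opt v : tangent_space g lhat v -> d2 e u z v = 0.
  rewrite TE => /span_rangeP[a ->]; elim/big_rec : _ => [|i y _ y0].
    by rewrite -D0 opt0.
  by rewrite d2_linearr// y0 addr0 [d2 _ _ _ _]opt0 mulr0.
have d2Bl x y v : d2 e u (x - y) v = d2 e u x v - d2 e u y v.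
  by rewrite addrC -scaleN1r d2_linearl// mulN1r addrC.
split.
  pose y := P h - P (kappa *: g lhat).
  have yT : tangent_space g lhat y 
    by exact: (tangent_spaceB Omi_partition lhat_pos g_sol).
  have yy0 : d2 e u y y = 0.
    have := P_orthogonal h _ yT; have := P_orthogonal (kappa *: g lhat) _ yT.
    have := opt _ yT; rewrite !d2Bl.
    move: (d2 e u (kappa *: g lhat) y) (d2 e u h y) (d2 e u (P h) y).
    move: (d2 e u (P (kappa *: g lhat)) y) => *; lra.
  apply/eqP; rewrite -subr_eq0 -normr_eq0 -sqrf_eq0 eq_le sqr_ge0 andbT.
  by rewrite -(ler_pM2l m_gt0) mulr0 (le_trans (e_coercive u y))// yy0.
rewrite TE; apply: span_range_has_dim => a aS.
have -> : \sum_i a i *: 'D_(delta_mx ord0 i) g lhat = D (\row_i a i).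
  rewrite /D (solution_derivative_basis Omi_partition lhat_pos g_sol).
  by apply: eq_bigr => i _; rewrite mxE.
move=> Da0 i; apply/eqP/negPn/negP => ai0.
have : i \in [set i : 'I_N | `[< ~ eq_g0_on e u (g lhat) (Omi i) >]]%SET.
  by apply: contraNT ai0 => /aS ->.
rewrite finset.inE => /asboolP; apply => phi v tphi vphi.
apply: (derivative_vanishes_local Omi_partition lhat_pos g_sol Da0 _ tphi vphi).
by rewrite mxE.
Qed.
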